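(* Let $m\ge2$, let $\overline{M}$ be a Riemann surface and let $[\xi]:\overline{M}\to Q^{m+2}_+$ be a holomorphic 1-isotropic curve. Then the envelope $\widehat{M}^m$ of the corresponding 2-parameter family of $m$-spheres in $\mathbb{S}^{m+2}$ is an $m$-dimensional Wintgen ideal submanifold of $\mathbb{S}^{m+2}$ wherever it is immersed, and $\widehat{M}^m$ has $[\xi]$ as its mean curvature sphere (i.e. at an immersed point of $\widehat{M}^m$ lying over $q\in\overline{M}$, the mean curvature sphere of $\widehat{M}^m$ is the $m$-sphere represented by $[\xi(q)]$).
   Context: **Wintgen ideal submanifolds (codimension two).** An $m$-dimensional submanifold of $\mathbb{S}^{m+2}$ is Wintgen ideal if equality holds in the DDVV inequality at every point; equivalently (and this is taken as the definition), at every point there are an orthonormal basis $\{e_1,\dots,e_m\}$ of the tangent space and an orthonormal basis $\{n_1,n_2\}$ of the normal space such that the shape operators have matrices $A_{n_1}=\lambda_1 I_m+\mu_0(E_{12}+E_{21})$ and $A_{n_2}=\lambda_2 I_m+\mu_0(E_{11}-E_{22})$ for some real $\lambda_1,\lambda_2,\mu_0$, where $E_{ij}$ are the matrix units. **Light-cone model.** $\mathbb{R}^{m+4}_1$ is $\mathbb{R}^{m+4}$ with $\langle Y,Z\rangle=-Y_0Z_0+Y_1Z_1+\cdots+Y_{m+3}Z_{m+3}$, extended complex bilinearly to $\mathbb{C}^{m+4}_1=\mathbb{R}^{m+4}_1\otimes\mathbb{C}$. A point $y\in\mathbb{S}^{m+2}\subset\mathbb{R}^{m+3}$ is identified with the light-like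 line $[(1,y)]$. An (oriented) spacelike 2-plane with orthonormal basis $\{\xi_1,\xi_2\}$ represents the round $m$-sphere of light-like lines orthogonal to it, and is identified with the point $[\xi_1-i\xi_2]$ of $$Q^{m+2}_+=\{[Z]\in\mathbb{C}P^{m+3}:\langle Z,Z\rangle=0,\ \langle Z,\bar Z\rangle>0\}.$$ **Mean curvature sphere.** For an immersion $x$ of an $m$-manifold into $\mathbb{S}^{m+2}$ with local orthonormal normal frame $\{n_1,n_2\}$ and mean curvature vector $H=\frac1m\mathrm{tr}(II)=H^1n_1+H^2n_2$, the mean curvature sphere at a point is the round $m$-sphere represented by $\mathrm{Span}\{\xi_1,\xi_2\}$ with $\xi_r=(H^r,\,n_r+H^rx)$; it is the unique $m$-sphere tangent to the submanifold at that point with the same mean curvature vector there. **Holomorphic 1-isotropic curves in $Q^{m+2}_+$.** A complex (holomorphic) curve is a holomorphic immersion $[\xi]:\overline{M}\to Q^{m+2}_+$ of a Riemann surface; in terms of a local lift $\xi$ and a local coordinate $z$, $\xi_{\bar z}=\lambda\xi$ for a local complex function $\lambda$. It is 1-isotropic if $d\xi$ is isotropic, i.e. $\langle\xi_z,\xi_z\rangle=0$. **Envelope.** Writing $\xi=\xi_1-i\xi_2$ with $\xi_1,\xi_2$ orthonormal, the corresponding 2-parameter family of $m$-spheres is $q\mapsto\mathrm{Span}_{\mathbb{R}}\{\xi_1(q),\xi_2(q)\}$. Its envelope $\widehat{M}^m$ consists of the pairs $(q,[Y])$ with $q\in\overline{M}$ and $[Y]$ a light-like line in the orthogonal complement of $\mathrm{Span}_{\mathbb{R}}\{\xi_1,\xi_2,d\xi_1,d\xi_2\}$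 at $q$ (the span being 4-dimensional and spacelike), with the map $(q,[Y])\mapsto[Y]\in\mathbb{S}^{m+2}$. ''Wherever it is immersed'' refers to the set of points near which this map is an immersion. *)

(* Defs.v *)
From HB Require Import structures.
From mathcomp Require Import all_boot all_order all_algebra.
From mathcomp Require Import all_classical all_reals all_analysis.
From mathcomp Require Import complex.

Set Implicit Arguments.
Unset Strict Implicit.
Unset Printing Implicit Defensive.

Import Order.TTheory GRing.Theory Num.Theory.
Import numFieldNormedType.Exports.

Local Open Scope classical_set_scope.
Local Open Scope complex_scope.
Local Open Scope ring_scope.

Section Smooth.
Context {R : realType} {V W : normedModType R}.

Fixpoint Ck (k : nat) (U : set V) (f : V -> W) : Prop :=
  if k is k'.+1 then
    (forall x, U x -> differentiable f x) /\
    (forall v, Ck k' U (fun x => 'D_v f x))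
  else forall x, U x -> {for x, continuous f}.

(* Meant for open U and finite-dimensional V. *)
Definition smooth (U : set V) (f : V -> W) : Prop := forall k, Ck k U f.

End Smooth.

(* The complex coordinate z = u + iv is encoded as the pair (u, v) : R * R. *)
Section RiemannSurface.
Context {R : realType}.

Definition mulJ (z : R * R) : R * R := (- z.2, z.1).

Definition holomorphic_at (g : R * R -> R * R) (z : R * R) : Prop :=
  differentiable g z /\ forall h, 'd g z (mulJ h) = mulJ ('d g z h).

Record chart (M : topologicalType) := Chart {
  cdom : set M;
  cmap : M -> R * R;
  cinv : R * R -> M;
  cdom_open : open cdom;
  cimg_open : open (cmap @` cdom);
  cmap_continuous : forall q, cdom q -> {for q, continuous cmap};
  cinv_continuous : forall z, (cmap @` cdom) z -> {for z, continuous cinv};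
  cmapK : forall q, cdom q -> cinv (cmap q) = q }.

Record riemannSurface := RiemannSurface {
  rs_sort :> topologicalType;
  rs_hausdorff : hausdorff_space rs_sort;
  rs_connected : connected [set: rs_sort];
  atlas : set (chart rs_sort);
  atlas_cover : forall q : rs_sort, exists2 c, atlas c & cdom c q;
  atlas_compat : forall c d, atlas c -> atlas d ->
    forall q, cdom c q -> cdom d q ->
      holomorphic_at (cmap d \o cinv c) (cmap c q) }.

End RiemannSurface.
Arguments chart R M : clear implicits.
Arguments riemannSurface R : clear implicits.

Section LightCone.

Definition lorentz {K : comPzRingType} {n : nat} (Y Z : 'rV[K]_n.+1) : K :=
  - (Y 0 ord0 * Z 0 ord0) +
  \sum_(i < n) Y 0 (lift ord0 i) * Z 0 (lift ord0 i).

Definition dot {K : comPzRingType} {n : nat} (y z : 'rV[K]_n) : K :=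
  \sum_(i < n) y 0 i * z 0 i.

Context {R : realType}.

Definition on_sphere {n : nat} (y : 'rV[R]_n) : Prop := dot y y = 1.

Definition lightvec {n : nat} (a : R) (y : 'rV[R]_n) : 'rV[R]_n.+1 :=
  row_mx (a%:M : 'rV[R]_1) y.

Definition Remx {n : nat} (Z : 'rV[R[i]]_n) : 'rV[R]_n :=
  map_mx (@complex.Re R) Z.
Definition Immx {n : nat} (Z : 'rV[R[i]]_n) : 'rV[R]_n :=
  map_mx (@complex.Im R) Z.
Definition cplxmx {n : nat} (A B : 'rV[R]_n) : 'rV[R[i]]_n :=
  \row_j (A 0 j +i* B 0 j).
Definition conj_row {n : nat} (Z : 'rV[R[i]]_n) : 'rV[R[i]]_n :=
  map_mx (@conjc R) Z.

(* Points of complex projective space are given by homogeneous coordinates,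
   compared with (Z == W)%MS, i.e. equality of the complex lines they span. *)
Definition in_Qplus {n : nat} (Z : 'rV[R[i]]_n.+1) : Prop :=
  lorentz Z Z = 0 /\ 0 < lorentz Z (conj_row Z).

Definition cplxD {n : nat} (f : R * R -> 'rV[R[i]]_n) (h z : R * R) :
    'rV[R[i]]_n :=
  cplxmx ('D_h (Remx \o f) z) ('D_h (Immx \o f) z).

Definition wirtz {n : nat} (f : R * R -> 'rV[R[i]]_n) (z : R * R) :=
  2^-1 *: (cplxD f (1, 0) z - 'i%C *: cplxD f (0, 1) z).
Definition wirtzbar {n : nat} (f : R * R -> 'rV[R[i]]_n) (z : R * R) :=
  2^-1 *: (cplxD f (1, 0) z + 'i%C *: cplxD f (0, 1) z).

End LightCone.

(* A map into CP^{n} is given by a choice X of homogeneous coordinates at each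
   point; no regularity is asked of X itself, only of its local lifts. *)
Section Curve.
Context {R : realType} {M : riemannSurface R} {n : nat}.
Variable X : M -> 'rV[R[i]]_n.+1.

Definition local_lift (c : chart R M) (W : set (R * R))
    (f : R * R -> 'rV[R[i]]_n.+1) : Prop :=
  [/\ open W, W `<=` cmap c @` cdom c,
      smooth W (Remx \o f), smooth W (Immx \o f) &
      forall z, W z -> (f z == X (cinv c z))%MS].

Definition smooth_curve : Prop :=
  forall q, exists c W f,
    [/\ atlas c, cdom c q, W (cmap c q) & local_lift c W f].

Definition holomorphic_curve : Prop :=
  forall c W f, atlas c -> local_lift c W f ->
    forall z, W z -> exists lambda : R[i], wirtzbar f z = lambda *: f z.

(* The tangent space of CP^n at the line [f z] is C^{n+1} modulo C f z. *)
Definition immersed_curve : Prop :=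
  forall c W f, atlas c -> local_lift c W f ->
    forall z, W z -> forall h, h != 0 -> ~~ (cplxD f h z <= f z)%MS.

Definition isotropic_curve : Prop :=
  forall c W f, atlas c -> local_lift c W f ->
    forall z, W z -> lorentz (wirtz f z) (wirtz f z) = 0.

Definition holomorphic_isotropic_curve : Prop :=
  [/\ forall q, in_Qplus (X q), smooth_curve, holomorphic_curve,
      immersed_curve & isotropic_curve].

(* A lift is written xi = xi1 - i xi2. *)
Definition xi1 (f : R * R -> 'rV[R[i]]_n.+1) : R * R -> 'rV[R]_n.+1 :=
  fun z => Remx (f z).
Definition xi2 (f : R * R -> 'rV[R[i]]_n.+1) : R * R -> 'rV[R]_n.+1 :=
  fun z => - Immx (f z).

Definition orthonormal_lift (c : chart R M) (W : set (R * R))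
    (f : R * R -> 'rV[R[i]]_n.+1) : Prop :=
  local_lift c W f /\
  forall z, W z -> [/\ lorentz (xi1 f z) (xi1 f z) = 1,
                       lorentz (xi2 f z) (xi2 f z) = 1 &
                       lorentz (xi1 f z) (xi2 f z) = 0].

(* Row space: Span {xi1, xi2, d xi1, d xi2} at z. *)
Definition osc_span (f : R * R -> 'rV[R[i]]_n.+1) (z : R * R) : 'M[R]_n.+1 :=
  (xi1 f z + xi2 f z + 'D_(1, 0) (xi1 f) z + 'D_(0, 1) (xi1 f) z
   + 'D_(1, 0) (xi2 f) z + 'D_(0, 1) (xi2 f) z)%MS.

Definition spacelike (S : 'M[R]_n.+1) : Prop :=
  forall w : 'rV[R]_n.+1, (w <= S)%MS -> w != 0 -> 0 < lorentz w w.

(* The light-like line [Y] is represented by its unique generator (1, y) with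
   y in the unit sphere.  Points q at which the osculating span degenerates
   carry no point of the envelope. *)
Definition envelope : set (M * 'rV[R]_n) :=
  [set p | exists c W f,
     [/\ atlas c, cdom c p.1, W (cmap c p.1) & orthonormal_lift c W f] /\
     let S := osc_span f (cmap c p.1) in
     [/\ \rank S = 4%N, spacelike S, on_sphere p.2 &
         forall w : 'rV[R]_n.+1, (w <= S)%MS -> lorentz w (lightvec 1 p.2) = 0]].

End Curve.

(* Smooth parametrizations of open pieces of a d-dimensional embedded
   submanifold N of M x R^n.  Smoothness of the component in M is required in
   some chart of the atlas around each point, equivalently in every one, since
   holomorphic transition maps are smooth. *)
Definition local_param {R : realType} {M : riemannSurface R} {n d : nat}
    (N : set (M * 'rV[R]_n)) (U : set 'rV[R]_d)
    (P : 'rV[R]_d -> M * 'rV[R]_n) : Prop :=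
  [/\ open U,
      forall u, U u -> {for u, continuous P},
      {in U &, injective P},
      forall U', open U' -> U' `<=` U ->
        exists2 O, open O & P @` U' = N `&` O &
      forall u, U u -> exists c U',
        [/\ atlas c, open U', U' u & U' `<=` U] /\
        [/\ forall u', U' u' -> cdom c (P u').1,
            smooth U' (fun u' => cmap c (P u').1),
            smooth U' (fun u' => (P u').2) &
            forall v, v != 0 ->
              'D_v (fun u' => cmap c (P u').1) u != 0 \/
              'D_v (fun u' => (P u').2) u != 0]].

Section SubmanifoldsOfSphere.
Context {R : realType} {m k : nat}.
(* x is a local parametrization of an m-dimensional immersed submanifold of the
   unit sphere of R^k; tangent vectors are given by coordinate rows in R^m. *)
Variables (x : 'rV[R]_m -> 'rV[R]_k) (u : 'rV[R]_m).

Definition immersed_near : Prop :=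
  \forall u' \near u, forall v, v != 0 -> 'D_v x u' != 0.

Definition first_form : 'M[R]_m :=
  \matrix_(i, j) dot ('D_(delta_mx 0 i) x u) ('D_(delta_mx 0 j) x u).

Definition normal_vec (n : 'rV[R]_k) : Prop :=
  dot n (x u) = 0 /\ forall v, dot n ('D_v x u) = 0.

(* <II(e_i, e_j), n>: the tangential part and the component of the second
   derivative along the position vector x u are killed by pairing with n. *)
Definition second_form (n : 'rV[R]_k) : 'M[R]_m :=
  \matrix_(i, j)
    dot ('D_(delta_mx 0 i) (fun u' => 'D_(delta_mx 0 j) x u') u) n.

(* Acts on coordinate rows: <A_n v, w> = <II(v, w), n>. *)
Definition shape_op (n : 'rV[R]_k) : 'M[R]_m :=
  second_form n *m invmx first_form.

Definition mean_curv (n : 'rV[R]_k) : R := m%:R^-1 * \tr (shape_op n).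

Definition normal_frame (n1 n2 : 'rV[R]_k) : Prop :=
  [/\ normal_vec n1, normal_vec n2, dot n1 n1 = 1, dot n2 n2 = 1 &
      dot n1 n2 = 0].

(* The rows of E are the coordinates of the basis. *)
Definition tangent_orthonormal_basis (E : 'M[R]_m) : Prop :=
  forall i j, dot ('D_(row i E) x u) ('D_(row j E) x u) = (i == j)%:R.

Definition Eunit (a b : nat) : 'M[R]_m :=
  \matrix_(i, j) ((i == a :> nat) && (j == b :> nat))%:R.

(* Codimension two: the sphere has dimension k - 1 = m + 2. *)
Definition wintgen_ideal_at : Prop :=
  exists (E : 'M[R]_m) (n1 n2 : 'rV[R]_k) (lambda1 lambda2 mu0 : R),
    [/\ tangent_orthonormal_basis E, normal_frame n1 n2,
        E *m shape_op n1 *m invmx E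
          = lambda1%:M + mu0 *: (Eunit 0 1 + Eunit 1 0) &
        E *m shape_op n2 *m invmx E
          = lambda2%:M + mu0 *: (Eunit 0 0 - Eunit 1 1)].

Definition mean_xi (n : 'rV[R]_k) : 'rV[R]_k.+1 :=
  lightvec (mean_curv n) (n + mean_curv n *: x u).

(* [Z] in Q_+ represents the plane spanned by Re Z and Im Z; its orientation is
   that of the normal frame, which is not fixed. *)
Definition mean_curvature_sphere_is (Z : 'rV[R[i]]_k.+1) : Prop :=
  forall n1 n2, normal_frame n1 n2 ->
    (mean_xi n1 + mean_xi n2 == Remx Z + Immx Z)%MS.

End SubmanifoldsOfSphere.

(* Main.v *)
Require Import Defs.
From mathcomp Require Import all_boot all_order all_algebra.
From mathcomp Require Import all_classical all_reals all_analysis.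
From mathcomp Require Import complex.
From mathcomp Require Import ring lra.

(** Let [xi = xi1 - i xi2] be an orthonormal lift of the curve, and let [a], [b]
be the derivatives of [xi1], [xi2] in the first coordinate direction.
Holomorphy says that, modulo [xi1] and [xi2], the derivatives in a direction
[(h1, h2)] are [h1 a + h2 b] and [h1 b - h2 a]; isotropy says that the
components of [a] and [b] orthogonal to [xi1] and [xi2] are orthogonal to each
other and of the same length ([lift_relations]).

Let [x] parametrize a piece of the envelope, let [zeta] be its base point in the
Riemann surface and [Y = (1, x)]. Since [Y] is orthogonal to [xi_r] and to its
derivatives, so is [dY] to [xi_r]: the spheres of the family are tangent to the
submanifold, and the spatial parts of [xi1], [xi2] are, up to multiples of [x],
an orthonormal normal frame. One more derivative shows that the second forms of
this frame are a multiple of the metric, the multiple being the time coordinate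
of [xi_r], plus the bilinear forms [- (p A + q B)] and [- (p B - q A)], where
[(p, q)] is the differential of [zeta] and [A], [B] are the restrictions of the
products with [a] and [b] to the tangent space. The orthogonal complement of [Y],
modulo [Y], is Euclidean and splits into the tangent space and the span of [xi1]
and [xi2]; hence [A] and [B] are orthogonal covectors of the same length. The
second forms are symmetric, which makes [p + i q] a complex multiple of [A - i B]
unless both covectors vanish. So the two bilinear forms are the real and
imaginary parts of a complex multiple of [(A - i B)^2]: they are traceless, they
have the shape demanded of a Wintgen ideal point in an orthonormal basis that
starts with the duals of [A] and [B], once the normal frame is changed by a
suitable orthogonal matrix, and the mean curvatures are the time coordinates of
[xi1] and [xi2], so that [xi] is the mean curvature sphere
([wintgen_of_isotropic_congruence]). Where the differential of [zeta] or the
factor relating it to [A - i B] vanishes, both bilinear forms are zero and the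
point is umbilic.

That the envelope is a submanifold rests on two facts. The osculating span is
spacelike of dimension four where a continuous function, [osc_gap], is positive.
And there the points of the envelope over [z] are the unit vectors of an affine
subspace depending smoothly on [z]; after prescribing enough fixed linear
coordinates there remains a line, whose intersection with the sphere is a root of
a quadratic equation with positive discriminant, a smooth function of the
parameters ([envelope_local_param]).

Points of the envelope are defined by arbitrary lifts in arbitrary charts;
[envelope_perp] reduces them to one fixed lift. *)

Import Order.TTheory GRing.Theory Num.Theory.
Import numFieldNormedType.Exports.
Local Open Scope classical_set_scope.
Local Open Scope complex_scope.
Local Open Scope ring_scope.

Set Implicit Arguments.
Unset Strict Implicit.
Unset Printing Implicit Defensive.

(** * Derivatives of vector-valued functions *)

Section Differentiability.
Context {R : realType} {V : normedModType R}.

(** Differentiability only depends on the germ: the first-order expansion of [f]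
at [x] serves for [g], since the two remainders agree near [x]. *)
Lemma near_eq_differentiable (W : normedModType R) (f g : V -> W) (x : V) :
  {near x, f =1 g} -> differentiable f x -> differentiable g x.
Proof.
move=> fg df.
have fgx : f x = g x by exact: (nbhs_singleton fg).
have cd := diff_continuous df.
suff e : g \o shift x = cst (g x) + 'd f x +o_ 0 id.
  by apply/diff_locallyP; rewrite (diff_unique cd e).
have /eqaddoP h := diff_locally df.
apply/eqaddoP => eps e0.
have h1 := h eps e0.
have h2 : \forall y \near (0 : V), f (y + x) = g (y + x).
  by move: fg; rewrite (near_shift 0) subr0.
near=> y.
have -> : (g \o shift x - (cst (g x) + 'd f x)) y
        = (f \o shift x - (cst (f x) + 'd f x)) y.
  rewrite !fctE /= -fgx; congr (_ - _); apply/esym.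
  by near: y; exact: h2.
by near: y; exact: h1.
Unshelve. all: by end_near. Qed.

Lemma differentiable_entry (a b : nat) (f : V -> 'M[R]_(a, b)) x i j :
  differentiable f x -> differentiable (fun t => f t i j) x.
Proof.
move=> df.
apply: (@differentiable_comp _ _ _ _ f (fun N : 'M[R]_(a, b) => N i j)) => //.
exact: differentiable_coord.
Qed.

Lemma derive_entry (a b : nat) (f : V -> 'M[R]_(a, b)) x v i j :
  differentiable f x -> 'D_v (fun t => f t i j) x = ('D_v f x) i j.
Proof. by move=> df; rewrite derive_mx ?mxE //; exact: diff_derivable. Qed.

(** A matrix is the finite sum of its entries times constant matrices. *)
Lemma differentiable_mx (a b : nat) (f : V -> 'M[R]_(a, b)) x :
  (forall i j, differentiable (fun t => f t i j) x) -> differentiable f x.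
Proof.
move=> df.
have -> : f = \sum_(i < a) \sum_(j < b) (fun t => f t i j *: delta_mx i j).
  apply/funext => t; rewrite fct_sumE [LHS]matrix_sum_delta.
  by apply: eq_bigr => i _; rewrite fct_sumE.
apply: differentiable_sum => i; apply: differentiable_sum => j.
exact: differentiableZl.
Qed.

Lemma deriveD_diff (W : normedModType R) (f : V -> W) x v w :
  differentiable f x -> 'D_(v + w) f x = 'D_v f x + 'D_w f x.
Proof. by move=> df; rewrite !deriveE // linearD. Qed.

Lemma deriveZ_diff (W : normedModType R) (f : V -> W) x (c : R) v :
  differentiable f x -> 'D_(c *: v) f x = c *: 'D_v f x.
Proof. by move=> df; rewrite !deriveE // linearZ. Qed.

Lemma derive_comp (W W' : normedModType R) (f : V -> W) (g : W -> W') x v :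
  differentiable f x -> differentiable g (f x) ->
  'D_v (g \o f) x = 'D_('D_v f x) g (f x).
Proof.
move=> df dg; rewrite (deriveE _ dg) (deriveE _ df) deriveE.
  by rewrite diff_comp.
exact: differentiable_comp.
Qed.

Lemma differentiable_dot n (f g : V -> 'rV[R]_n) x :
  differentiable f x -> differentiable g x ->
  differentiable (fun t => dot (f t) (g t)) x.
Proof.
move=> df dg.
have -> : (fun t => dot (f t) (g t))
        = \sum_(i < n) ((fun t => f t 0 i) * (fun t => g t 0 i)).
  by apply/funext => t; rewrite fct_sumE.
apply: differentiable_sum => i.
by apply: differentiableM; exact: differentiable_entry.
Qed.

Lemma derive_dot n (f g : V -> 'rV[R]_n) x v :
  differentiable f x -> differentiable g x ->
  'D_v (fun t => dot (f t) (g t)) x = dot ('D_v f x) (g x) + dot (f x) ('D_v g x).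
Proof.
move=> df dg.
have -> : (fun t => dot (f t) (g t))
        = \sum_(i < n) ((fun t => f t 0 i) * (fun t => g t 0 i)).
  by apply/funext => t; rewrite fct_sumE.
have dfi i : derivable (fun t => f t 0 i) x v.
  by apply/diff_derivable/differentiable_entry.
have dgi i : derivable (fun t => g t 0 i) x v.
  by apply/diff_derivable/differentiable_entry.
rewrite derive_sum; last by move=> i; exact: derivableM.
rewrite -big_split /=; apply: eq_bigr => i _.
by rewrite deriveM // !derive_entry // addrC; congr (_ + _); exact: mulrC.
Qed.

End Differentiability.

Lemma derive_plane {R : realType} (W : normedModType R) (g : R * R -> W) z h :
  differentiable g z ->
  'D_h g z = h.1 *: 'D_(1, 0) g z + h.2 *: 'D_(0, 1) g z.
Proof.
move=> dg; rewrite -(deriveZ_diff _ _ dg) -(deriveZ_diff _ _ dg) -(deriveD_diff _ _ dg).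
congr ('D_ _ g _); apply: injective_projections => /=.
  by rewrite /GRing.scale /= mulr1 mulr0 addr0.
by rewrite /GRing.scale /= mulr1 mulr0 add0r.
Qed.

(** * Smooth functions *)

Section Smoothness.
Context {R : realType} {V : normedModType R}.
Variable U : set V.
Hypothesis openU : open U.

Lemma eq_on_open_near (T : Type) (f g : V -> T) x :
  (forall t, U t -> f t = g t) -> U x -> {near x, f =1 g}.
Proof.
move=> fg Ux; have : \forall t \near x, U t by exact: open_nbhs_nbhs.
by apply: filterS => t /fg.
Qed.

Lemma derive_locally_constant (W : normedModType R) (f : V -> W) (c : W) x v :
  (forall t, U t -> f t = c) -> U x -> 'D_v f x = 0.
Proof.
move=> fc Ux; rewrite (@near_eq_derive _ _ _ f (fun=> c)) ?derive_cst //.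
exact: eq_on_open_near.
Qed.

(** The iterated derivatives at a point of an open set only see the values on
that set; this lets the closure lemmas below replace a derivative by the
formula that computes it on [U]. *)
Lemma Ck_ext (W : normedModType R) k (f g : V -> W) :
  (forall t, U t -> f t = g t) -> Ck k U f -> Ck k U g.
Proof.
elim: k f g => [|k IH] f g fg /=.
  move=> cf x Ux; have cfx : f @ x --> g x by rewrite -fg //; exact: cf.
  by apply: cvg_trans cfx; apply: near_eq_cvg; exact: eq_on_open_near.
move=> [df dk]; split => [x Ux|v].
  by apply: near_eq_differentiable (df x Ux); exact: eq_on_open_near.
apply: IH (dk v) => t Ut.
by apply: near_eq_derive; exact: eq_on_open_near.
Qed.

Lemma CkW (W : normedModType R) k (f : V -> W) : Ck k.+1 U f -> Ck k U f.
Proof.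
elim: k f => [|k IH] f /= [df dk].
  by move=> x Ux; exact/differentiable_continuous/df.
by split => // v; exact: IH (dk v).
Qed.

Lemma Ck_cst (W : normedModType R) k (c : W) : Ck k U (fun=> c).
Proof.
elim: k c => [|k IH] c /=; first by move=> x _; exact: cst_continuous.
split => [x _|v]; first exact: differentiable_cst.
by under eq_fun do rewrite derive_cst; exact: IH.
Qed.

Lemma CkD (W : normedModType R) k (f g : V -> W) :
  Ck k U f -> Ck k U g -> Ck k U (fun t => f t + g t).
Proof.
elim: k f g => [|k IH] f g /=.
  by move=> cf cg x Ux; apply: cvgD; [exact: cf|exact: cg].
move=> [df dfk] [dg dgk]; split => [x Ux|v].
  by apply: differentiableD; [exact: df|exact: dg].
apply: (@Ck_ext _ _ (fun t => 'D_v f t + 'D_v g t)); last exact: IH.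
move=> t Ut; rewrite -deriveD //; apply: diff_derivable; [exact: df|exact: dg].
Qed.

Lemma CkM k (f g : V -> R) :
  Ck k U f -> Ck k U g -> Ck k U (fun t => f t * g t).
Proof.
elim: k f g => [|k IH] f g.
  by move=> /= cf cg x Ux; apply: cvgM; [exact: cf|exact: cg].
move=> /[dup] /CkW fk [df dfk] /[dup] /CkW gk [dg dgk]; split => [x Ux|v].
  by apply: differentiableM; [exact: df|exact: dg].
apply: (@Ck_ext _ _ (fun t => f t * 'D_v g t + g t * 'D_v f t)).
  move=> t Ut; rewrite -deriveM //; apply: diff_derivable; [exact: df|exact: dg].
by apply: CkD; [exact: IH fk (dgk v)|exact: IH gk (dfk v)].
Qed.

(** Induction on the order: the derivative of [1 / f] is a polynomial in [1 / f]
and the derivative of [f], to which the induction hypothesis applies. The square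
root below is treated in the same way. *)
Lemma CkV k (f : V -> R) : (forall t, U t -> f t != 0) ->
  Ck k U f -> Ck k U (fun t => (f t)^-1).
Proof.
move=> f0; elim: k => [|k IH].
  by move=> cf x Ux; apply: cvgV; [exact: f0|exact: cf].
move=> /[dup] /CkW fk [df dfk]; split => [x Ux|v].
  by apply: differentiableV; [exact: df|exact: f0].
apply: (@Ck_ext _ _ (fun t => -1 * ((f t)^-1 * (f t)^-1) * 'D_v f t)).
  move=> t Ut; rewrite deriveV ?f0 //; last exact/diff_derivable/df.
  by rewrite mulN1r -invfM -expr2.
apply: CkM; last exact: dfk v.
apply: CkM; first exact: Ck_cst.
by apply: CkM; exact: IH.
Qed.

Lemma differentiable_sqrt (x : R) : 0 < x -> differentiable (@Num.sqrt R) x.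
Proof. by move=> x0; have [d _] := is_derive1_sqrt x0; exact/derivable1_diffP. Qed.

Lemma Ck_sqrt k (f : V -> R) : (forall t, U t -> 0 < f t) ->
  Ck k U f -> Ck k U (fun t => Num.sqrt (f t)).
Proof.
move=> f0; elim: k => [|k IH].
  move=> cf x Ux; apply: continuous_comp; first exact: cf.
  exact: sqrt_continuous.
move=> /[dup] /CkW fk [df dfk]; split => [x Ux|v].
  apply: (@differentiable_comp _ _ _ _ f Num.sqrt); first exact: df.
  exact/differentiable_sqrt/f0.
apply: (@Ck_ext _ _ (fun t => (2 * Num.sqrt (f t))^-1 * 'D_v f t)).
  move=> t Ut; have dft := df t Ut; have ds := differentiable_sqrt (f0 t Ut).
  rewrite [RHS](derive_comp _ dft ds).
  have [_ <-] := is_derive1_sqrt (f0 t Ut).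
  have -> : 'D_v f t = 'D_v f t *: (1 : R) by rewrite /GRing.scale /= mulr1.
  by rewrite (deriveZ_diff _ _ ds) /GRing.scale /= mulr1 mulrC.
apply: CkM; last exact: dfk v.
apply: CkV.
  by move=> t /f0 ft; rewrite mulf_neq0 // gt_eqF // sqrtr_gt0.
by apply: CkM; [exact: Ck_cst|exact: IH].
Qed.

Lemma smooth_ext (W : normedModType R) (f g : V -> W) :
  (forall t, U t -> f t = g t) -> smooth U f -> smooth U g.
Proof. by move=> fg sf k; apply: Ck_ext (sf k). Qed.

Lemma smooth_differentiable (W : normedModType R) (f : V -> W) x :
  smooth U f -> U x -> differentiable f x.
Proof. by move=> sf Ux; have [/(_ x Ux)] := sf 1%N. Qed.

Lemma smooth_continuous (W : normedModType R) (f : V -> W) x :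
  smooth U f -> U x -> {for x, continuous f}.
Proof. by move=> sf Ux; exact: (sf 0%N). Qed.

Lemma smooth_derive (W : normedModType R) (f : V -> W) v :
  smooth U f -> smooth U (fun x => 'D_v f x).
Proof. by move=> sf k; have [_ sk] := sf k.+1; exact: sk. Qed.

Lemma smooth_cst (W : normedModType R) (c : W) : smooth U (fun=> c).
Proof. by move=> k; exact: Ck_cst. Qed.

Lemma smoothD (W : normedModType R) (f g : V -> W) :
  smooth U f -> smooth U g -> smooth U (fun t => f t + g t).
Proof. by move=> sf sg k; exact: CkD. Qed.

Lemma smoothM (f g : V -> R) :
  smooth U f -> smooth U g -> smooth U (fun t => f t * g t).
Proof. by move=> sf sg k; exact: CkM. Qed.

Lemma smoothN (f : V -> R) : smooth U f -> smooth U (fun t => - f t).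
Proof.
move=> sf; apply: (@smooth_ext _ (fun t => -1 * f t)).
  by move=> t _; rewrite mulN1r.
by apply: smoothM => //; exact: smooth_cst.
Qed.

Lemma smoothV (f : V -> R) : (forall t, U t -> f t != 0) ->
  smooth U f -> smooth U (fun t => (f t)^-1).
Proof. by move=> f0 sf k; exact: CkV. Qed.

Lemma smooth_sqrt (f : V -> R) : (forall t, U t -> 0 < f t) ->
  smooth U f -> smooth U (fun t => Num.sqrt (f t)).
Proof. by move=> f0 sf k; exact: Ck_sqrt. Qed.

Lemma smooth_sum I (r : seq I) (P : pred I) (f : I -> V -> R) :
  (forall i, smooth U (f i)) -> smooth U (fun t => \sum_(i <- r | P i) f i t).
Proof.
move=> sf; elim: r => [|i r IH].
  by under eq_fun do rewrite big_nil; exact: smooth_cst.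
under eq_fun do rewrite big_cons.
by case: (P i) => //; exact: smoothD.
Qed.

Lemma smooth_prod I (r : seq I) (f : I -> V -> R) :
  (forall i, smooth U (f i)) -> smooth U (fun t => \prod_(i <- r) f i t).
Proof.
move=> sf; elim: r => [|i r IH].
  by under eq_fun do rewrite big_nil; exact: smooth_cst.
by under eq_fun do rewrite big_cons; exact: smoothM.
Qed.

Lemma smooth_entry (a b : nat) (f : V -> 'M[R]_(a, b)) i j :
  smooth U f -> smooth U (fun t => f t i j).
Proof.
move=> sf k; elim: k f sf => [|k IH] f sf /=.
  move=> x Ux; apply: differentiable_continuous.
  exact/differentiable_entry/(smooth_differentiable sf).
split => [x Ux|v].
  exact/differentiable_entry/(smooth_differentiable sf).
apply: (@Ck_ext _ _ (fun t => ('D_v f t) i j)); last exact/IH/smooth_derive.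
by move=> t Ut; rewrite derive_entry //; exact: smooth_differentiable sf _.
Qed.

(** The directional derivatives of [f] have as entries the derivatives of the
entries, so the induction on the order passes through entrywise smoothness. *)
Lemma smooth_mx (a b : nat) (f : V -> 'M[R]_(a, b)) :
  (forall i j, smooth U (fun t => f t i j)) -> smooth U f.
Proof.
move=> sf k.
have df (g : V -> 'M[R]_(a, b)) x : (forall i j, smooth U (fun t => g t i j)) ->
    U x -> differentiable g x.
  move=> sg Ux; apply: differentiable_mx => i j.
  exact: smooth_differentiable (sg i j) Ux.
elim: k f sf => [|k IH] f sf /=.
  by move=> x Ux; exact/differentiable_continuous/df.
split => [x Ux|v]; first exact: df.
apply: IH => i j; apply: (@smooth_ext _ ('D_v (fun t => f t i j))).
  by move=> t Ut; rewrite derive_entry //; exact: df.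
exact: smooth_derive.
Qed.

Lemma smooth_mxE (a b : nat) (f : V -> 'M[R]_(a, b)) (g : 'I_a -> 'I_b -> V -> R) :
  (forall t i j, f t i j = g i j t) -> (forall i j, smooth U (g i j)) ->
  smooth U f.
Proof.
move=> fg sg; apply: smooth_mx => i j.
by under eq_fun do rewrite fg; exact: sg.
Qed.

Lemma smooth_mulmx (a b c : nat) (f : V -> 'M[R]_(a, b)) (g : V -> 'M[R]_(b, c)) :
  smooth U f -> smooth U g -> smooth U (fun t => f t *m g t).
Proof.
move=> sf sg; apply: smooth_mxE => [t i j|]; first by rewrite mxE.
move=> i j; apply: smooth_sum => l.
by apply: smoothM; exact: smooth_entry.
Qed.

Lemma smooth_scalemx (a b : nat) (f : V -> R) (g : V -> 'M[R]_(a, b)) :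
  smooth U f -> smooth U g -> smooth U (fun t => f t *: g t).
Proof.
move=> sf sg; apply: smooth_mxE => [t i j|]; first by rewrite mxE.
by move=> i j; apply: smoothM => //; exact: smooth_entry.
Qed.

Lemma smooth_trmx (a b : nat) (f : V -> 'M[R]_(a, b)) :
  smooth U f -> smooth U (fun t => (f t)^T).
Proof.
move=> sf; apply: smooth_mxE => [t i j|]; first by rewrite mxE.
by move=> i j; exact: smooth_entry.
Qed.

Lemma smooth_row_mx (a b c : nat) (f : V -> 'M[R]_(a, b)) (g : V -> 'M[R]_(a, c)) :
  smooth U f -> smooth U g -> smooth U (fun t => row_mx (f t) (g t)).
Proof.
move=> sf sg; apply: smooth_mx => i j; case: (split_ordP j) => l ->.
  by under eq_fun do rewrite row_mxEl; exact: smooth_entry.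
by under eq_fun do rewrite row_mxEr; exact: smooth_entry.
Qed.

Lemma smooth_col_mx (a b c : nat) (f : V -> 'M[R]_(a, c)) (g : V -> 'M[R]_(b, c)) :
  smooth U f -> smooth U g -> smooth U (fun t => col_mx (f t) (g t)).
Proof.
move=> sf sg; apply: smooth_mx => i j; case: (split_ordP i) => l ->.
  by under eq_fun do rewrite col_mxEu; exact: smooth_entry.
by under eq_fun do rewrite col_mxEd; exact: smooth_entry.
Qed.

Lemma smooth_det n (f : V -> 'M[R]_n) :
  smooth U f -> smooth U (fun t => \det (f t)).
Proof.
move=> sf; apply: smooth_sum => s; apply: smoothM; first exact: smooth_cst.
by apply: smooth_prod => i; exact: smooth_entry.
Qed.

(** By Cramer's rule the entries of the inverse are polynomials in the entries
and in the inverse of the determinant. *)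
Lemma smooth_invmx n (f : V -> 'M[R]_n) : (forall t, U t -> f t \in unitmx) ->
  smooth U f -> smooth U (fun t => invmx (f t)).
Proof.
move=> fu sf.
apply: (@smooth_ext _ (fun t => (\det (f t))^-1 *: \adj (f t))).
  by move=> t Ut; rewrite /invmx fu.
apply: smooth_scalemx.
  apply: smoothV; last exact: smooth_det.
  by move=> t /fu; rewrite unitmxE unitfE.
apply: smooth_mxE => [t i j|]; first by rewrite mxE.
move=> i j; apply: smoothM; first exact: smooth_cst.
apply: smooth_det; apply: smooth_mxE => [t a b|]; first by rewrite !mxE.
by move=> a b; exact: smooth_entry.
Qed.

Lemma smooth_dot n (f g : V -> 'rV[R]_n) :
  smooth U f -> smooth U g -> smooth U (fun t => dot (f t) (g t)).
Proof.
by move=> sf sg; apply: smooth_sum => i; apply: smoothM; exact: smooth_entry.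
Qed.

Lemma smooth_lorentz n (f g : V -> 'rV[R]_n.+1) :
  smooth U f -> smooth U g -> smooth U (fun t => lorentz (f t) (g t)).
Proof.
move=> sf sg; apply: smoothD.
  by apply: smoothN; apply: smoothM; exact: smooth_entry.
by apply: smooth_sum => i; apply: smoothM; exact: smooth_entry.
Qed.

Lemma smooth_id : smooth U (@id V).
Proof.
case=> [|k] /=; first by move=> x _; exact: cvg_id.
split=> [x _|v]; first exact: ex_diff.
by under eq_fun do rewrite derive_id; exact: Ck_cst.
Qed.

Lemma open_pos_locus (f : V -> R) : (forall x, U x -> {for x, continuous f}) ->
  open [set x | U x /\ 0 < f x].
Proof.
move=> cf; rewrite openE => x [Ux fx].
have nU : \forall t \near x, U t by exact: open_nbhs_nbhs.
have nf : \forall t \near x, 0 < f t by exact: cvgr_gt (cf x Ux) _ fx.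
by apply: filterS2 nU nf.
Qed.

Lemma smooth_sub (U' : set V) (W : normedModType R) (f : V -> W) :
  U' `<=` U -> smooth U f -> smooth U' f.
Proof.
move=> sub sf k; move: (sf k) => {sf}; elim: k f => [|k IH] f /=.
  by move=> cf x /sub; exact: cf.
by move=> [df dfk]; split=> [x /sub|v]; [exact: df|exact: IH (dfk v)].
Qed.

End Smoothness.

(** [L'] is the constant derivative of [L], so the derivative of [f \o L] in a
direction is again of the form [f' \o L] and the induction on the order closes
without a chain rule for higher derivatives. *)
Lemma smooth_comp_affine {R : realType} {V V' W : normedModType R}
    (L : V' -> V) (L' : V' -> V) (U : set V) (U' : set V') (f : V -> W) :
  open U' -> (forall x, differentiable L x) -> (forall x h, 'D_h L x = L' h) ->
  (forall x, U' x -> U (L x)) -> smooth U f -> smooth U' (f \o L).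
Proof.
move=> oU' dL DL UU sf k.
have dfL g x : smooth U g -> U' x -> differentiable ((g : V -> W) \o L) x.
  move=> sg /UU Ux; apply: differentiable_comp => //.
  exact: smooth_differentiable sg Ux.
elim: k f sf => [|k IH] f sf /=.
  by move=> x Ux; exact/differentiable_continuous/dfL.
split => [x Ux|v]; first exact: dfL.
apply: (@Ck_ext _ _ _ _ _ _ ((fun y => 'D_(L' v) f y) \o L)) => //.
  move=> x Ux /=; have df := smooth_differentiable sf (UU x Ux).
  by rewrite derive_comp // DL.
exact/IH/smooth_derive.
Qed.

(** * Symmetry of second derivatives *)

Section SymmetryOfSecondDerivatives.
Context {R : realType} {V : normedModType R}.
Variable U : set V.
Hypothesis openU : open U.

Lemma is_derive_line (g : V -> R) (p v : V) (s : R) :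
  differentiable g (p + s *: v) ->
  is_derive s 1 (fun r : R => g (p + r *: v)) ('D_v g (p + s *: v)).
Proof.
move=> /(diff_derivable (v := v)) dg.
have e : (fun h : R => h^-1 *: (g (p + (h *: (1 : R) + s) *: v) - g (p + s *: v)))
       = (fun h : R => h^-1 *: (g (h *: v + (p + s *: v)) - g (p + s *: v))).
  by apply/funext => h; rewrite [h%:A]mulr1 scalerDl addrCA.
by split; rewrite /derivable /derive /= e.
Qed.

Lemma mean_value_on_segment (phi dphi : R -> R) (t : R) : 0 < t ->
  (forall s, 0 <= s <= t -> is_derive s 1 phi (dphi s)) ->
  exists2 s, 0 <= s <= t & phi t - phi 0 = dphi s * t.
Proof.
move=> t0 dp.
have dp_oo c : c \in `]0, t[%R -> is_derive c 1 phi (dphi c).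
  by rewrite in_itv => /andP[/ltW c0 /ltW ct]; apply: dp; rewrite c0 ct.
have cont : {within `[0, t], continuous phi}.
  apply: derivable_within_continuous => c; rewrite in_itv => /= ct.
  by have [] := dp c ct.
have [s st] := MVT t0 dp_oo cont; rewrite subr0 => e; exists s => //.
by move: st; rewrite in_itv => /andP[/ltW -> /ltW ->].
Qed.

(** The mean value theorem applied in direction [v] to the difference of two
parallel restrictions of [g], and then in direction [w] to ['D_v g]. *)
Lemma second_difference_mean_value (g : V -> R) (x v w : V) (t : R) :
  smooth U g -> 0 < t ->
  (forall s r, 0 <= s <= t -> 0 <= r <= t -> U (x + s *: v + r *: w)) ->
  exists s r, [/\ 0 <= s <= t, 0 <= r <= t &
    g (x + t *: v + t *: w) - g (x + t *: v) - g (x + t *: w) + g x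
      = 'D_w ('D_v g) (x + s *: v + r *: w) * t * t].
Proof.
move=> sg t0 inU.
have in0 : 0 <= (0 : R) <= t by rewrite lexx ltW.
have int : 0 <= t <= t by rewrite lexx ltW.
pose phi (s : R) := g (x + t *: w + s *: v) - g (x + s *: v).
pose dphi (s : R) := 'D_v g (x + t *: w + s *: v) - 'D_v g (x + s *: v).
have dp s : 0 <= s <= t -> is_derive s 1 phi (dphi s).
  move=> st; apply: is_deriveB; apply: is_derive_line.
    by apply: smooth_differentiable sg _; rewrite addrAC; exact: inU.
  apply: smooth_differentiable sg _.
  by have := inU _ _ st in0; rewrite scale0r addr0.
have [s st e1] := mean_value_on_segment t0 dp.
pose psi (r : R) := 'D_v g (x + s *: v + r *: w).
pose dpsi (r : R) := 'D_w ('D_v g) (x + s *: v + r *: w).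
have dq r : 0 <= r <= t -> is_derive r 1 psi (dpsi r).
  move=> rt; apply: is_derive_line.
  by apply: smooth_differentiable (smooth_derive v sg) _; exact: inU.
have [r rt e2] := mean_value_on_segment t0 dq.
exists s, r; split => //; rewrite -/(dpsi r) -e2.
have -> : psi t - psi 0 = dphi s.
  by rewrite /psi /dphi scale0r addr0 addrAC.
rewrite -e1 /phi scale0r !addr0 (addrAC x (t *: w)).
ring.
Qed.

(** The second difference of [g] over a small parallelogram is [t * t] times a
value of either mixed derivative near [x], whichever direction comes first;
continuity of both mixed derivatives makes them equal at [x]. *)
Lemma derive_sym (g : V -> R) (x v w : V) : smooth U g -> U x ->
  'D_v ('D_w g) x = 'D_w ('D_v g) x.
Proof.
move=> sg Ux.
have [h1 [h1E s1]] : exists h : V -> R,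
    (forall y, 'D_v ('D_w g) y = h y) /\ smooth U h.
  by exists ('D_v ('D_w g)); split=> [//|]; exact: smooth_derive v (smooth_derive w sg).
have [h2 [h2E s2]] : exists h : V -> R,
    (forall y, 'D_w ('D_v g) y = h y) /\ smooth U h.
  by exists ('D_w ('D_v g)); split=> [//|]; exact: smooth_derive w (smooth_derive v sg).
rewrite h1E h2E.
apply/eqP; rewrite -subr_eq0 -normr_le0.
apply/ler_addgt0Pr => e e0; rewrite add0r.
have e2 : 0 < e / 2 by rewrite divr_gt0.
have near_x (h : V -> R) : smooth U h ->
    \forall y \near x, U y /\ `|h x - h y| < e / 2.
  move=> sh; apply: filterI; first exact: open_nbhs_nbhs.
  by have /cvgrPdist_lt := smooth_continuous sh Ux; exact.
pose plane (p : R * R) := x + p.1 *: v + p.2 *: w.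
have plane0 : plane (0, 0) = x by rewrite /plane /= !scale0r !addr0.
have cplane : plane @ (0, 0) --> x.
  rewrite -[X in _ --> X]plane0.
  apply: cvgD; first apply: cvgD; first exact: cvg_cst.
    by apply: cvgZr_tmp; exact: cvg_fst.
  by apply: cvgZr_tmp; exact: cvg_snd.
pose G := [set y | [/\ U y, `|h1 x - h1 y| < e / 2
                      & `|h2 x - h2 y| < e / 2]].
have Gx : nbhs x G.
  by apply: filterS2 (near_x _ s1) (near_x _ s2) => y [Uy ?] [_ ?].
have Gplane : nbhs ((0, 0) : R * R) (plane @^-1` G) := cplane _ Gx.
move: Gplane => /nbhs_ballP[d /= d0 near_p].
pose t := d / 2; have t0 : 0 < t by rewrite divr_gt0.
have in_ball s : 0 <= s <= t -> `|s| < d.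
  by move=> /andP[s0 st]; rewrite ger0_norm // (le_lt_trans st) // gtr_pMr ?invf_lt1 ?ltr1n.
have good s r : 0 <= s <= t -> 0 <= r <= t -> G (plane (s, r)).
  move=> /in_ball sd /in_ball rd; apply: near_p.
  by split => /=; rewrite -ball_normE /= sub0r normrN.
have [] := @second_difference_mean_value g x v w t sg t0.
  by move=> s r /good /[apply] -[].
move=> s [r [s0t r0t E1]]; rewrite h2E in E1.
have [] := @second_difference_mean_value g x w v t sg t0.
  by move=> s' r' hs hr; have [] := good _ _ hr hs; rewrite /plane /= addrAC.
move=> s' [r' [s0t' r0t' E2]]; rewrite h1E in E2.
have E3 : h1 (plane (r', s')) = h2 (plane (s, r)).
  apply: (mulIf (lt0r_neq0 t0)); apply: (mulIf (lt0r_neq0 t0)).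
  by rewrite -E1 /plane /= addrAC -E2 (addrAC x (t *: v)); ring.
have [_ _ c2] := good _ _ s0t r0t.
have [_ c1 _] := good _ _ r0t' s0t'.
rewrite E3 in c1.
have -> : h1 x - h2 x
    = (h1 x - h2 (plane (s, r))) - (h2 x - h2 (plane (s, r))) by ring.
by rewrite (le_trans (ler_normB _ _)) // [leRHS]splitr ltW // ltrD.
Qed.

Lemma derive_sym_mx (a b : nat) (f : V -> 'M[R]_(a, b)) (x v w : V) :
  smooth U f -> U x -> 'D_v ('D_w f) x = 'D_w ('D_v f) x.
Proof.
move=> sf Ux; apply/matrixP => i j.
have swapE y z : ('D_y ('D_z f) x) i j = 'D_y ('D_z (fun t => f t i j)) x.
  rewrite -derive_entry; last exact: smooth_differentiable (smooth_derive z sf) Ux.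
  apply: near_eq_derive; apply: (eq_on_open_near openU _ Ux) => t Ut.
  by rewrite derive_entry //; exact: smooth_differentiable sf Ut.
have sij := smooth_entry openU i j sf.
have h := derive_sym v w sij Ux.
exact: etrans (swapE v w) (etrans h (esym (swapE w v))).
Qed.

End SymmetryOfSecondDerivatives.

(** * Euclidean and Lorentzian products *)

Section Forms.
Context {K : comPzRingType}.
Implicit Types n : nat.

Lemma dotE n (y z : 'rV[K]_n) : dot y z = (y *m z^T) 0 0.
Proof. by rewrite mxE; apply: eq_bigr => i _; rewrite mxE. Qed.

Lemma dotC n (y z : 'rV[K]_n) : dot y z = dot z y.
Proof. by apply: eq_bigr => i _; rewrite mulrC. Qed.

Lemma dotDl n (x y z : 'rV[K]_n) : dot (x + y) z = dot x z + dot y z.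
Proof. by rewrite !dotE mulmxDl mxE. Qed.

Lemma dotZl n (a : K) (y z : 'rV[K]_n) : dot (a *: y) z = a * dot y z.
Proof. by rewrite !dotE -scalemxAl mxE. Qed.

Lemma dotDr n (x y z : 'rV[K]_n) : dot x (y + z) = dot x y + dot x z.
Proof. by rewrite dotC dotDl !(dotC x). Qed.

Lemma dotZr n (a : K) (y z : 'rV[K]_n) : dot y (a *: z) = a * dot y z.
Proof. by rewrite dotC dotZl dotC. Qed.

Lemma dotNl n (y z : 'rV[K]_n) : dot (- y) z = - dot y z.
Proof. by rewrite -scaleN1r dotZl mulN1r. Qed.

Lemma dotNr n (y z : 'rV[K]_n) : dot y (- z) = - dot y z.
Proof. by rewrite dotC dotNl dotC. Qed.

Lemma dot0l n (y : 'rV[K]_n) : dot 0 y = 0.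
Proof. by rewrite dotE mul0mx mxE. Qed.

Lemma lorentz_dot n (Y Z : 'rV[K]_n.+1) :
  lorentz Y Z = dot Y Z - Y 0 0 * Z 0 0 *+ 2.
Proof.
rewrite /lorentz /dot big_ord_recl addrC mulr2n opprD !addrA; congr (_ + _).
by rewrite addrAC subrr add0r.
Qed.

Lemma lorentzC n (Y Z : 'rV[K]_n.+1) : lorentz Y Z = lorentz Z Y.
Proof. by rewrite !lorentz_dot dotC mulrC. Qed.

Lemma lorentzDl n (X Y Z : 'rV[K]_n.+1) :
  lorentz (X + Y) Z = lorentz X Z + lorentz Y Z.
Proof. by rewrite !lorentz_dot dotDl mxE mulrDl mulrnDl opprD addrACA. Qed.

Lemma lorentzZl n (a : K) (Y Z : 'rV[K]_n.+1) :
  lorentz (a *: Y) Z = a * lorentz Y Z.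
Proof. by rewrite !lorentz_dot dotZl mxE -mulrA -mulrnAr -mulrBr. Qed.

Lemma lorentzDr n (X Y Z : 'rV[K]_n.+1) :
  lorentz X (Y + Z) = lorentz X Y + lorentz X Z.
Proof. by rewrite lorentzC lorentzDl !(lorentzC X). Qed.

Lemma lorentzZr n (a : K) (Y Z : 'rV[K]_n.+1) :
  lorentz Y (a *: Z) = a * lorentz Y Z.
Proof. by rewrite lorentzC lorentzZl lorentzC. Qed.

Lemma lorentzNl n (Y Z : 'rV[K]_n.+1) : lorentz (- Y) Z = - lorentz Y Z.
Proof. by rewrite -scaleN1r lorentzZl mulN1r. Qed.

Lemma lorentzNr n (Y Z : 'rV[K]_n.+1) : lorentz Y (- Z) = - lorentz Y Z.
Proof. by rewrite lorentzC lorentzNl lorentzC. Qed.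

Lemma lorentz0l n (Y : 'rV[K]_n.+1) : lorentz 0 Y = 0.
Proof. by rewrite -(scale0r 0) lorentzZl mul0r. Qed.

Definition lorentz_bilin := (lorentzDl, lorentzDr, lorentzZl, lorentzZr,
  lorentzNl, lorentzNr).

Definition dot_bilin := (dotDl, dotDr, dotZl, dotZr, dotNl, dotNr).

End Forms.

Section LightVectors.
Context {R : realType}.
Implicit Types n : nat.

(** Splitting off the time coordinate: the inverse of [lightvec]. *)
Definition spatial n (Y : 'rV[R]_n.+1) : 'rV[R]_n := rsubmx (Y : 'rV_(1 + n)).

Lemma lightvec_spatial n (Y : 'rV[R]_n.+1) : Y = lightvec (Y 0 0) (spatial Y).
Proof.
apply: etrans (esym (hsubmxK (Y : 'rV_(1 + n)))) _.
rewrite /lightvec /spatial; congr row_mx.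
by rewrite [LHS]mx11_scalar !mxE; congr (_%:M); congr (Y 0 _); exact: val_inj.
Qed.

Lemma lightvecE0 n a (y : 'rV[R]_n) : lightvec a y 0 0 = a.
Proof.
have -> : (0 : 'I_n.+1) = lshift n (0 : 'I_1) by exact: val_inj.
by rewrite [LHS]row_mxEl mxE.
Qed.

Lemma spatial_lightvec n a (y : 'rV[R]_n) : spatial (lightvec a y) = y.
Proof. exact: row_mxKr. Qed.

Lemma lorentz_spatial n (Y Z : 'rV[R]_n.+1) :
  lorentz Y Z = dot (spatial Y) (spatial Z) - Y 0 0 * Z 0 0.
Proof.
rewrite /lorentz addrC; congr (_ - _); apply: eq_bigr => i _; rewrite !mxE.
by congr (Y _ _ * Z _ _); exact: val_inj.
Qed.

Lemma lorentz_lightvec n (Y : 'rV[R]_n.+1) a (y : 'rV[R]_n) :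
  lorentz Y (lightvec a y) = dot (spatial Y) y - Y 0 0 * a.
Proof. by rewrite lorentz_spatial spatial_lightvec lightvecE0. Qed.

Lemma lightvecD n (a b : R) (y z : 'rV[R]_n) :
  lightvec (a + b) (y + z) = lightvec a y + lightvec b z.
Proof. by rewrite /lightvec raddfD /= -add_row_mx. Qed.

Lemma lightvecZ n (a b : R) (y : 'rV[R]_n) :
  lightvec (a * b) (a *: y) = a *: lightvec b y.
Proof. by rewrite /lightvec -scale_scalar_mx -scale_row_mx. Qed.

Lemma spatialD n (Y Z : 'rV[R]_n.+1) : spatial (Y + Z) = spatial Y + spatial Z.
Proof. by rewrite /spatial linearD. Qed.

Lemma spatialZ n (a : R) (Y : 'rV[R]_n.+1) : spatial (a *: Y) = a *: spatial Y.
Proof. by rewrite /spatial linearZ. Qed.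

Lemma spatialN n (Y : 'rV[R]_n.+1) : spatial (- Y) = - spatial Y.
Proof. by rewrite /spatial linearN. Qed.

Lemma dot_ge0 n (y : 'rV[R]_n) : 0 <= dot y y.
Proof. by apply: sumr_ge0 => i _; rewrite -expr2 sqr_ge0. Qed.

Lemma dot_eq0 n (y : 'rV[R]_n) : (dot y y == 0) = (y == 0).
Proof.
apply/idP/eqP => [|->]; last by rewrite dot0l.
rewrite psumr_eq0 => [/allP y0|i _]; last by rewrite -expr2 sqr_ge0.
apply/rowP => i; rewrite mxE; apply/eqP.
by have := y0 i (mem_index_enum i); rewrite mulf_eq0 orbb.
Qed.

Lemma dot_gt0 n (y : 'rV[R]_n) : y != 0 -> 0 < dot y y.
Proof. by move=> y0; rewrite lt_def dot_ge0 dot_eq0 y0. Qed.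

Lemma differentiable_lorentz (V : normedModType R) n (f g : V -> 'rV[R]_n.+1) x :
  differentiable f x -> differentiable g x ->
  differentiable (fun t => lorentz (f t) (g t)) x.
Proof.
move=> df dg; under eq_fun do rewrite lorentz_dot.
apply: differentiableB; first exact: differentiable_dot.
under eq_fun do rewrite mulr2n.
by apply: differentiableD; apply: differentiableM; exact: differentiable_entry.
Qed.

Lemma derive_lorentz (V : normedModType R) n (f g : V -> 'rV[R]_n.+1) x v :
  differentiable f x -> differentiable g x ->
  'D_v (fun t => lorentz (f t) (g t)) x
    = lorentz ('D_v f x) (g x) + lorentz (f x) ('D_v g x).
Proof.
move=> df dg; under eq_fun do rewrite lorentz_dot mulr2n.
have df0 : differentiable (fun t => f t 0 0) x by exact: differentiable_entry.
have dg0 : differentiable (fun t => g t 0 0) x by exact: differentiable_entry.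
have d00 : differentiable (fun t => f t 0 0 * g t 0 0) x.
  exact: differentiableM.
rewrite deriveB; first last.
- by apply: diff_derivable; exact: differentiableD.
- by apply: diff_derivable; exact: differentiable_dot.
rewrite deriveD; try exact: diff_derivable.
rewrite deriveM; try exact: diff_derivable.
rewrite derive_dot // !derive_entry // !lorentz_dot /GRing.scale /=.
ring.
Qed.

End LightVectors.

(** * Orthonormal bases and traceless pairs of forms *)

Section LinearAlgebra.
Context {R : realType}.

Definition gram m (G : 'M[R]_m) (v w : 'rV[R]_m) : R := (v *m G *m w^T) 0 0.

Lemma gram_sym m (G : 'M[R]_m) v w : G^T = G -> gram G v w = gram G w v.
Proof.
move=> Gs; rewrite /gram -[in RHS]Gs -[w in RHS]trmxK -trmx_mul -mulmxA.
by rewrite -[v in RHS]trmxK -trmx_mul [RHS]mxE trmxK mulmxA.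
Qed.

(** The Gram-Schmidt step: fewer than [m] linear conditions leave a nonzero
vector, which is then normalized. The family is indexed by [nat], and only its
values below the current length matter. *)
Lemma extend_orthonormal m (G : 'M[R]_m) k (e : nat -> 'rV[R]_m) :
  G^T = G -> (forall v, v != 0 -> 0 < gram G v v) -> (k <= m)%N ->
  (forall i j, (i < k)%N -> (j < k)%N -> gram G (e i) (e j) = (i == j)%:R) ->
  exists e' : nat -> 'rV[R]_m, (forall i, (i < k)%N -> e' i = e i) /\
    forall i j, (i < m)%N -> (j < m)%N -> gram G (e' i) (e' j) = (i == j)%:R.
Proof.
move=> Gs Gpos; move Ed : (m - k)%N => d.
elim: d k e Ed => [|d IH] k e Ed le_km ortho.
  have le_mk : (m <= k)%N by rewrite -subn_eq0 Ed.
  by exists e; split => // i j im jm; apply: ortho; exact: leq_trans le_mk.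
have lt_km : (k < m)%N by rewrite -subn_gt0 Ed.
pose N := \matrix_(i < m, j < k) (G *m (e j)^T) i 0.
have : kermx N != 0.
  rewrite -mxrank_eq0 mxrank_ker -lt0n subn_gt0.
  by apply: leq_ltn_trans lt_km; exact: rank_leq_col.
move=> /rowV0Pn[w /sub_kermxP wN w0].
have we i : (i < k)%N -> gram G w (e i) = 0.
  move=> ik; have <- : (w *m N) 0 (Ordinal ik) = 0 by rewrite wN mxE.
  rewrite /gram -mulmxA mxE [RHS]mxE.
  by apply: eq_bigr => j _; rewrite [N _ _]mxE.
have ww := Gpos w w0; pose s := Num.sqrt (gram G w w).
have s0 : s != 0 by rewrite gt_eqF // sqrtr_gt0.
pose e1 i := if (i < k)%N then e i else s^-1 *: w.
have gZl v : gram G (s^-1 *: w) v = s^-1 * gram G w v.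
  by rewrite /gram -!scalemxAl mxE.
have e1k i : (i < k)%N -> gram G (s^-1 *: w) (e i) = 0.
  by move=> ik; rewrite gZl we // mulr0.
have e1w : gram G (s^-1 *: w) (s^-1 *: w) = 1.
  rewrite gZl gram_sym // gZl mulrA -expr2 exprVn sqr_sqrtr ?ltW //.
  by rewrite mulVf // gt_eqF.
have lt_cases l : (l < k.+1)%N -> l = k \/ (l < k)%N.
  by rewrite ltnS leq_eqVlt => /predU1P.
have [||i j|e2 [e2e1 orth2]] := IH k.+1 e1 => //.
- by rewrite subnS Ed.
- rewrite /e1 => /lt_cases[->|ik] /lt_cases[->|jk].
  + by rewrite ltnn eqxx.
  + by rewrite ltnn jk e1k // gtn_eqF.
  + by rewrite ltnn ik gram_sym // e1k // ltn_eqF.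
  + by rewrite ik jk ortho.
exists e2; split => // i ik.
by rewrite e2e1 /e1 ?ik // ltnS ltnW.
Qed.

Lemma orthonormal_mx m (G : 'M[R]_m) (e : nat -> 'rV[R]_m) :
  (forall i j, (i < m)%N -> (j < m)%N -> gram G (e i) (e j) = (i == j)%:R) ->
  (\matrix_(i < m) e i) *m G *m (\matrix_(i < m) e i)^T = 1%:M.
Proof.
move=> orth; apply/matrixP => i j.
rewrite [RHS]mxE; apply: etrans (orth i j (ltn_ord i) (ltn_ord j)).
rewrite /gram [LHS]mxE [RHS]mxE.
apply: eq_bigr => l _; rewrite !mxE; congr (_ * _).
by apply: eq_bigr => l' _; rewrite !mxE.
Qed.

(** When the coordinate vectors of [A] and [B] in one orthonormal basis are
orthogonal of the same length [s], dividing them by [s] gives the first two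
vectors of another one, in which both covectors are multiples of coordinate
covectors. For [s = 0] both vanish and any orthonormal basis will do. *)
Lemma isotropic_basis m (G E0 : 'M[R]_m.+2) (A B : 'cV[R]_m.+2) :
  G^T = G -> (forall v, v != 0 -> 0 < gram G v v) -> E0 *m G *m E0^T = 1%:M ->
  dot (E0 *m A)^T (E0 *m A)^T = dot (E0 *m B)^T (E0 *m B)^T ->
  dot (E0 *m A)^T (E0 *m B)^T = 0 ->
  exists (E : 'M[R]_m.+2) (s : R),
    [/\ E *m G *m E^T = 1%:M, E *m A = s *: delta_mx 0 0 &
        E *m B = s *: delta_mx (lift 0 0) 0].
Proof.
move=> Gs Gpos E0G; set al := E0 *m A; set be := E0 *m B => eqn orth.
have E0u : E0 \in unitmx by move: E0G; rewrite -mulmxA => /mulmx1_unit[].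
pose s := Num.sqrt (dot al^T al^T).
have ss : s * s = dot al^T al^T by rewrite -expr2 sqr_sqrtr // dot_ge0.
have [s0|s0] := eqVneq s 0.
  exists E0, 0; rewrite !scale0r; split => //.
    by apply/eqP; rewrite -trmx_eq0 -dot_eq0 -/al -ss s0 mul0r.
  by apply/eqP; rewrite -trmx_eq0 -dot_eq0 -/be -eqn -ss s0 mul0r.
pose row_of (c : 'cV[R]_m.+2) : 'rV[R]_m.+2 := s^-1 *: (c^T *m E0).
have GE0 : G *m E0^T = invmx E0.
  by rewrite -[LHS](mulKmx E0u) (mulmxA E0) E0G mulmx1.
have gramE c v : gram G v (row_of (E0 *m c)) = s^-1 * (v *m c) 0 0.
  rewrite /gram /row_of linearZ /= trmx_mul trmxK -scalemxAr mxE; congr (_ * _).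
  by rewrite mulmxA -(mulmxA v) GE0 -mulmxA mulKmx.
have row_ofE c d : (row_of (E0 *m c) *m d) 0 0 = s^-1 * dot (E0 *m c)^T (E0 *m d)^T.
  by rewrite dotE trmxK /row_of -scalemxAl mxE -mulmxA.
pose e i := if i is 0%N then row_of al else row_of be.
have orth_e i j : (i < 2)%N -> (j < 2)%N -> gram G (e i) (e j) = (i == j)%:R.
  case: i => [|[|//]] _; case: j => [|[|//]] _; rewrite /e gramE row_ofE.
  - by rewrite -/al -ss mulrA -invfM mulVf // mulf_neq0.
  - by rewrite orth !mulr0.
  - by rewrite dotC orth !mulr0.
  - by rewrite -/be -eqn -ss mulrA -invfM mulVf // mulf_neq0.
have [e' [e'E orth']] := extend_orthonormal Gs Gpos (isT : (2 <= m.+2)%N) orth_e.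
have entryE c v : (v *m c) 0 0 = s * gram G v (row_of (E0 *m c)).
  by rewrite gramE mulrA mulfV // mul1r.
have colE c k : (k < 2)%N -> e k = row_of (E0 *m c) ->
    forall i : 'I_m.+2, ((\matrix_(i < m.+2) e' i) *m c) i 0 = s * (i == k :> nat)%:R.
  move=> k2 ek i; rewrite -(orth' i k) //; last exact: leq_trans k2 _.
  rewrite (e'E k) // ek -entryE !mxE; apply: eq_bigr => l _; rewrite mxE //.
exists (\matrix_(i < m.+2) e' i), s; split; first exact: orthonormal_mx.
  by apply/colP => i; rewrite (colE A 0%N) // !mxE andbT.
by apply/colP => i; rewrite (colE B 1%N) // !mxE andbT.
Qed.

(** With [theta1], [theta2] the first two coordinate forms, this is the real form
of [B1 - i B2 = - s (p + i q) (theta1 - i theta2)]. Symmetry of [B1] and [B2]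
forces [p + i q] to be a complex multiple of [theta1 - i theta2] unless [s = 0],
so that [B1 - i B2] is a multiple of [(theta1 - i theta2)^2]; the unit complex
number [d + i c] is the phase of this multiple and [mu] its modulus. *)
Lemma traceless_pair_form m (B1 B2 : 'M[R]_m.+2) (p q : 'cV[R]_m.+2) (s : R) :
  let a : 'cV[R]_m.+2 := s *: delta_mx 0 0 in
  let b : 'cV[R]_m.+2 := s *: delta_mx (lift 0 0) 0 in
  B1 = - (p *m a^T + q *m b^T) -> B2 = - (p *m b^T - q *m a^T) ->
  B1^T = B1 -> B2^T = B2 ->
  exists c d mu : R, [/\ c ^+ 2 + d ^+ 2 = 1,
    B1 = mu *: (c *: (Eunit 0 1 + Eunit 1 0) + d *: (Eunit 0 0 - Eunit 1 1)) &
    B2 = mu *: (d *: (Eunit 0 1 + Eunit 1 0) - c *: (Eunit 0 0 - Eunit 1 1))].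
Proof.
move=> a b eB1 eB2 sym1 sym2.
have B1E i j : B1 i j = - (s * (p i 0 * (j == 0%N :> nat)%:R + q i 0 * (j == 1%N :> nat)%:R)).
  rewrite eB1 !mxE !big_ord1 !mxE !andbT -!(inj_eq val_inj) /=.
  ring.
have B2E i j : B2 i j = - (s * (p i 0 * (j == 1%N :> nat)%:R - q i 0 * (j == 0%N :> nat)%:R)).
  rewrite eB2 !mxE !big_ord1 !mxE !andbT -!(inj_eq val_inj) /=.
  ring.
have B1s i j : B1 i j = B1 j i by rewrite -[in LHS]sym1 mxE.
have B2s i j : B2 i j = B2 j i by rewrite -[in LHS]sym2 mxE.
pose i0 : 'I_m.+2 := 0; pose i1 : 'I_m.+2 := lift 0 0.
pose P := s * p i0 0; pose Q := s * p i1 0.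
have q0 : s * q i0 0 = Q.
  have := B1s i0 i1; rewrite !B1E /= !mulr0 !mulr1 add0r addr0.
  by move/oppr_inj.
have q1 : s * q i1 0 = - P.
  have := B2s i0 i1; rewrite !B2E /= !mulr0 !mulr1 sub0r subr0.
  by rewrite mulrN opprK /P => ->.
have pqE i : s * p i 0 = P * (i == 0%N :> nat)%:R + Q * (i == 1%N :> nat)%:R /\
             s * q i 0 = Q * (i == 0%N :> nat)%:R - P * (i == 1%N :> nat)%:R.
  case: i => [[|[|i]] hi].
  - have -> : Ordinal hi = i0 by exact: val_inj.
    by rewrite q0 /= !mulr0 !mulr1 addr0 subr0.
  - have -> : Ordinal hi = i1 by exact: val_inj.
    by rewrite q1 /= !mulr0 !mulr1 add0r sub0r.
  have h0 := B1s (Ordinal hi) i0; have h1 := B1s (Ordinal hi) i1.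
  move: h0 h1; rewrite !B1E /= !(mulr0, mulr1, addr0, add0r, oppr0).
  by move=> /eqP; rewrite oppr_eq0 => /eqP -> /eqP; rewrite oppr_eq0 => /eqP ->.
(* Polar coordinates of (P, Q), with an arbitrary phase at the origin. *)
have [c [d [mu [cd Pd Qc]]]] : exists c d mu : R,
    [/\ c ^+ 2 + d ^+ 2 = 1, - P = mu * d & - Q = mu * c].
  have [PQ0|PQ0] := eqVneq (P ^+ 2 + Q ^+ 2) 0.
    exists 1, 0, 0; rewrite expr1n expr0n addr0 !mul0r; split => //.
      by apply/eqP; rewrite oppr_eq0 -sqrf_eq0; move/eqP: PQ0; rewrite paddr_eq0 ?sqr_ge0 // => /andP[].
    by apply/eqP; rewrite oppr_eq0 -sqrf_eq0; move/eqP: PQ0; rewrite paddr_eq0 ?sqr_ge0 // => /andP[].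
  pose mu := Num.sqrt (P ^+ 2 + Q ^+ 2).
  have mu2 : mu ^+ 2 = P ^+ 2 + Q ^+ 2 by rewrite sqr_sqrtr // addr_ge0 ?sqr_ge0.
  have mu0 : mu != 0 by rewrite -sqrf_eq0 mu2.
  exists (- Q / mu), (- P / mu), mu; split; try by rewrite mulrC divfK.
  by rewrite !exprMn !sqrrN -mulrDl addrC -mu2 exprVn mulfV // sqrf_eq0.
have PE : P = - (mu * d) by rewrite -Pd opprK.
have QE : Q = - (mu * c) by rewrite -Qc opprK.
exists c, d, mu; split => //; apply/matrixP => i j.
  have [pE qE] := pqE i.
  rewrite B1E mulrDr !mulrA pE qE !mxE -!mulnb !natrM.
  by rewrite PE QE; ring.
have [pE qE] := pqE i.
rewrite B2E mulrBr !mulrA pE qE !mxE -!mulnb !natrM.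
by rewrite PE QE; ring.
Qed.

Lemma umbilic_rank2E n (c : R) (G : 'M[R]_n) (p q A B : 'cV[R]_n) i j :
  (c *: G - (p *m A^T + q *m B^T)) i j
    = c * G i j - (p i 0 * A j 0 + q i 0 * B j 0).
Proof. by rewrite !mxE !big_ord1 !mxE. Qed.

Lemma orthonormal_col_mx a b n (A : 'M[R]_(a, n)) (B : 'M[R]_(b, n)) :
  A *m A^T = 1%:M -> B *m B^T = 1%:M -> A *m B^T = 0 ->
  col_mx A B *m (col_mx A B)^T = 1%:M.
Proof.
move=> AA BB AB; have BA : B *m A^T = 0.
  by apply: trmx_inj; rewrite trmx_mul trmxK AB trmx0.
by rewrite tr_col_mx mul_col_mx !mul_mx_row AA BB AB BA -block_mxEv -scalar_mx_block.
Qed.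

End LinearAlgebra.

(** * Submanifolds of the sphere at one point *)

Section SubmanifoldPointwise.
Context {R : realType} {m : nat}.
Variables (x : 'rV[R]_m.+2 -> 'rV[R]_m.+2.+3) (u : 'rV[R]_m.+2).
Hypothesis dx : differentiable x u.
Hypothesis x_sphere : dot (x u) (x u) = 1.
Hypothesis x_perp : forall v, dot (x u) ('D_v x u) = 0.
Hypothesis x_immersed : forall v, v != 0 -> 'D_v x u != 0.

Let J : 'M[R]_(m.+2, m.+2.+3) := \matrix_(i < m.+2) 'D_(delta_mx 0 i) x u.
Let G := first_form x u.

Lemma derive_jacobian v : 'D_v x u = v *m J.
Proof.
rewrite deriveE // [in LHS](row_sum_delta v) linear_sum mulmx_sum_row.
by apply: eq_bigr => i _; rewrite linearZ /= rowK deriveE.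
Qed.

Lemma first_form_jacobian : G = J *m J^T.
Proof.
apply/matrixP => i j; rewrite !mxE; apply: eq_bigr => k _.
by rewrite !mxE.
Qed.

Lemma first_form_sym : G^T = G.
Proof. by rewrite first_form_jacobian trmx_mul trmxK. Qed.

Lemma gram_first_form v w : gram G v w = dot ('D_v x u) ('D_w x u).
Proof.
by rewrite /gram first_form_jacobian !derive_jacobian dotE trmx_mul !mulmxA.
Qed.

Lemma first_form_gt0 v : v != 0 -> 0 < gram G v v.
Proof. by move=> v0; rewrite gram_first_form dot_gt0 // x_immersed. Qed.

Lemma orthonormal_tangent_basis : exists E : 'M[R]_m.+2, E *m G *m E^T = 1%:M.
Proof.
have [] := @extend_orthonormal R _ G 0 (fun=> 0) first_form_sym first_form_gt0 (leq0n _).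
  by [].
by move=> e [_ orth]; exists (\matrix_(i < m.+2) e i); exact: orthonormal_mx.
Qed.

Lemma second_formD n1 n2 : second_form x u (n1 + n2) = second_form x u n1 + second_form x u n2.
Proof. by apply/matrixP => i j; rewrite !mxE dotDr. Qed.

Lemma second_formZ c n1 : second_form x u (c *: n1) = c *: second_form x u n1.
Proof. by apply/matrixP => i j; rewrite !mxE dotZr. Qed.

Lemma mean_curvD n1 n2 : mean_curv x u (n1 + n2) = mean_curv x u n1 + mean_curv x u n2.
Proof. by rewrite /mean_curv /shape_op second_formD mulmxDl mxtraceD mulrDr. Qed.

Lemma mean_curvZ c n1 : mean_curv x u (c *: n1) = c * mean_curv x u n1.
Proof. by rewrite /mean_curv /shape_op second_formZ -scalemxAl mxtraceZ mulrCA. Qed.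

Lemma mean_xiD n1 n2 : mean_xi x u (n1 + n2) = mean_xi x u n1 + mean_xi x u n2.
Proof.
by rewrite /mean_xi -lightvecD mean_curvD scalerDl addrACA.
Qed.

Lemma mean_xiZ c n1 : mean_xi x u (c *: n1) = c *: mean_xi x u n1.
Proof.
by rewrite /mean_xi -lightvecZ mean_curvZ scalerDr scalerA.
Qed.

Section Frame.
Variables (n1 n2 : 'rV[R]_m.+2.+3) (E : 'M[R]_m.+2).
Hypothesis frame : normal_frame x u n1 n2.
Hypothesis E_orth : E *m G *m E^T = 1%:M.

(** The position vector, the normal frame and an orthonormal tangent basis
together form an orthonormal basis of the ambient space, so the matrix of its
rows is orthogonal on both sides. *)
Lemma frame_decomposition z :
  z = dot z (x u) *: x u + dot z n1 *: n1 + dot z n2 *: n2 + z *m (E *m J)^T *m (E *m J).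
Proof.
have [[n1x n1D] [n2x n2D] n11 n22 n12] := frame.
pose O : 'M[R]_(1 + (1 + (1 + m.+2)), m.+2.+3) :=
  col_mx (x u) (col_mx n1 (col_mx n2 (E *m J))).
have perpE (n : 'rV_m.+2.+3) : (forall v, dot n ('D_v x u) = 0) -> n *m (E *m J)^T = 0.
  move=> nD; apply/rowP => i; rewrite [RHS]mxE -(nD (row i E)).
  rewrite derive_jacobian -row_mul dotE mxE [RHS]mxE.
  by apply: eq_bigr => j _; rewrite !mxE.
have EJ : (E *m J) *m (E *m J)^T = 1%:M.
  by rewrite trmx_mul -E_orth first_form_jacobian !mulmxA.
have dot11 (y z0 : 'rV[R]_m.+2.+3) : y *m z0^T = (dot y z0)%:M.
  by rewrite dotE -mx11_scalar.
have OO : O *m O^T = 1%:M.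
  apply: orthonormal_col_mx; first by rewrite dot11 x_sphere.
    apply: orthonormal_col_mx; first by rewrite dot11 n11.
      apply: orthonormal_col_mx; [by rewrite dot11 n22|exact: EJ|exact: perpE].
    by rewrite tr_col_mx mul_mx_row dot11 n12 perpE // raddf0 row_mx0.
  rewrite !tr_col_mx !mul_mx_row !dot11 (dotC (x u)) n1x (dotC (x u)) n2x perpE //.
  by rewrite raddf0 !row_mx0.
have OO' : O^T *m O = 1%:M by exact: (mulmx1C OO).
rewrite -[LHS]mulmx1 -OO' mulmxA /O !tr_col_mx !mul_mx_row !mul_row_col !dot11.
by rewrite !mul_scalar_mx !addrA.
Qed.

Lemma parseval y z :
  dot y z = dot y (x u) * dot z (x u) + dot y n1 * dot z n1 + dot y n2 * dot z n2
            + dot (y *m (E *m J)^T) (z *m (E *m J)^T).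
Proof.
rewrite [in LHS](frame_decomposition y) !dot_bilin !(dotC _ z).
congr (_ + _); rewrite (dotC z) !dotE; congr (fun_of_matrix _ 0 0).
by rewrite [(z *m _)^T]trmx_mul trmxK !mulmxA.
Qed.

Lemma normal_decomposition n : normal_vec x u n ->
  n = dot n n1 *: n1 + dot n n2 *: n2.
Proof.
move=> [nx nD]; rewrite [LHS]frame_decomposition nx scale0r add0r.
have -> : n *m (E *m J)^T = 0; last by rewrite mul0mx addr0.
apply/rowP => i; rewrite [RHS]mxE -(nD (row i E)) derive_jacobian -row_mul.
by rewrite dotE mxE [RHS]mxE; apply: eq_bigr => j _; rewrite !mxE.
Qed.

(** In the basis [E] the inverse of the first form is [E^T E], so that the trace of
the shape operator is that of the conjugated second form. *)
Lemma mean_curv_of_form n a (B : 'M[R]_m.+2) :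
  second_form x u n = a *: G + B -> \tr (E *m B *m E^T) = 0 ->
  mean_curv x u n = a.
Proof.
move=> SB trB.
have GEE : G *m (E^T *m E) = 1%:M by rewrite mulmxA; apply: mulmx1C; rewrite mulmxA.
have [Gu _] := mulmx1_unit GEE.
have Ginv : invmx G = E^T *m E by rewrite -[LHS]mulmx1 -GEE mulKmx.
rewrite /mean_curv /shape_op SB mulmxDl mxtraceD -/G -scalemxAl mulmxV //.
rewrite mxtraceZ mxtrace1 Ginv mulmxA mxtrace_mulC mulmxA trB addr0 mulrCA.
by rewrite mulVf ?mulr1 // pnatr_eq0.
Qed.

Lemma trace_wintgen_form (c d mu : R) :
  \tr (mu *: (c *: (Eunit 0 1 + Eunit 1 0) + d *: (Eunit 0 0 - Eunit 1 1))
       : 'M[R]_m.+2) = 0.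
Proof.
rewrite /mxtrace big_ord_recl big_ord_recl big1; last first.
  by move=> i _; rewrite !mxE /= !(mulr0, addr0, subr0).
rewrite !mxE /=; ring.
Qed.

Lemma shape_op_conj n : E *m shape_op x u n *m invmx E = E *m second_form x u n *m E^T.
Proof.
have GEE : G *m (E^T *m E) = 1%:M by rewrite mulmxA; apply: mulmx1C; rewrite mulmxA.
have [Gu _] := mulmx1_unit GEE.
have [Eu _] : E \in unitmx /\ G *m E^T \in unitmx.
  by apply: mulmx1_unit; rewrite mulmxA.
have Ginv : invmx G = E^T *m E by rewrite -[LHS]mulmx1 -GEE mulKmx.
by rewrite /shape_op -/G Ginv !mulmxA mulmxK.
Qed.

Lemma tangent_basis : tangent_orthonormal_basis x u E.
Proof.
move=> i j; rewrite -gram_first_form /gram.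
have -> : (i == j)%:R = (1%:M : 'M[R]_m.+2) i j by rewrite mxE.
rewrite -E_orth -row_mul [RHS]mxE mxE; apply: eq_bigr => l _; by rewrite !mxE.
Qed.

(** Replacing the normal frame by its image under the orthogonal matrix with rows
[(c, d)] and [(d, - c)] brings the pair of second forms to the required shape
without changing the tangent basis. *)
Lemma wintgen_of_rotated_forms (a1 a2 c d mu : R) (B1 B2 : 'M[R]_m.+2) :
  second_form x u n1 = a1 *: G + B1 -> second_form x u n2 = a2 *: G + B2 ->
  c ^+ 2 + d ^+ 2 = 1 ->
  E *m B1 *m E^T
    = mu *: (c *: (Eunit 0 1 + Eunit 1 0) + d *: (Eunit 0 0 - Eunit 1 1)) ->
  E *m B2 *m E^T
    = mu *: (d *: (Eunit 0 1 + Eunit 1 0) - c *: (Eunit 0 0 - Eunit 1 1)) ->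
  [/\ wintgen_ideal_at x u, mean_curv x u n1 = a1 & mean_curv x u n2 = a2].
Proof.
move=> S1 S2 cd EB1 EB2; split; first last.
- by apply: mean_curv_of_form S2 _; rewrite EB2 -scaleNr trace_wintgen_form.
- by apply: mean_curv_of_form S1 _; rewrite EB1 trace_wintgen_form.
have [[n1x n1D] [n2x n2D] n11 n22 n12] := frame.
have conjS n a B : second_form x u n = a *: G + B ->
    E *m second_form x u n *m E^T = a%:M + E *m B *m E^T.
  move=> ->; rewrite mulmxDr mulmxDl -scalemxAr -scalemxAl E_orth.
  by rewrite scalemx1.
exists E, (c *: n1 + d *: n2), (d *: n1 - c *: n2), (c * a1 + d * a2), (d * a1 - c * a2), mu.
split; first exact: tangent_basis.
- have n21 : dot n2 n1 = 0 by rewrite dotC.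
  split.
  + by split=> [|v]; rewrite !dot_bilin ?n1x ?n2x ?n1D ?n2D !mulr0 addr0.
  + by split=> [|v]; rewrite !dot_bilin ?n1x ?n2x ?n1D ?n2D !mulr0 oppr0 addr0.
  + by rewrite !dot_bilin n11 n22 n12 n21 -[RHS]cd; ring.
  + by rewrite !dot_bilin n11 n22 n12 n21 -[RHS]cd; ring.
  + by rewrite !dot_bilin n11 n22 n12 n21; ring.
- rewrite shape_op_conj second_formD !second_formZ mulmxDr mulmxDl.
  rewrite -!scalemxAr -!scalemxAl (conjS _ _ _ S1) (conjS _ _ _ S2) EB1 EB2.
  move: (Eunit 0 1 + _) (Eunit 0 0 - _) => O D.
  apply/matrixP => i j; rewrite !mxE -[X in _ = _ + X]mul1r -cd.
  case: (i == j) => /=; ring.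
- rewrite shape_op_conj second_formD -scaleNr !second_formZ mulmxDr mulmxDl.
  rewrite -!scalemxAr -!scalemxAl (conjS _ _ _ S1) (conjS _ _ _ S2) EB1 EB2.
  move: (Eunit 0 1 + _) (Eunit 0 0 - _) => O D.
  apply/matrixP => i j; rewrite !mxE -[X in _ = _ + X]mul1r -cd.
  case: (i == j) => /=; ring.
Qed.

(** [mean_xi] is linear in the normal vector, and two orthonormal frames span the
same normal plane. *)
Lemma mean_sphere_frame_indep (n1' n2' : 'rV[R]_m.+2.+3) :
  normal_frame x u n1' n2' ->
  (mean_xi x u n1' + mean_xi x u n2' <= mean_xi x u n1 + mean_xi x u n2)%MS.
Proof.
move=> [v1 v2 _ _ _].
have sub n : normal_vec x u n ->
    (mean_xi x u n <= mean_xi x u n1 + mean_xi x u n2)%MS.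
  move=> /normal_decomposition ->; rewrite mean_xiD !mean_xiZ.
  by rewrite addmx_sub_adds // scalemx_sub.
by rewrite addsmx_sub !sub.
Qed.

End Frame.
End SubmanifoldPointwise.

(** * Isotropic congruences of tangent spheres *)

Section TangentSphereCongruence.
Context {R : realType}.

Lemma lightvecES n (c : R) (y : 'rV[R]_n) j : lightvec c y 0 (lift ord0 j) = y 0 j.
Proof.
have -> : lift ord0 j = rshift 1 j by exact: val_inj.
by rewrite [LHS]row_mxEr.
Qed.

Lemma differentiable_lightvec (V : normedModType R) n c (y : V -> 'rV[R]_n) t :
  differentiable y t -> differentiable (fun t => lightvec c (y t)) t.
Proof.
move=> dy; apply: differentiable_mx => i j; rewrite ord1.
case: (unliftP ord0 j) => [k|] ->.
  by under eq_fun do rewrite lightvecES; exact: differentiable_entry.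
by under eq_fun do rewrite lightvecE0; exact: differentiable_cst.
Qed.

Lemma derive_lightvec (V : normedModType R) n c (y : V -> 'rV[R]_n) t v :
  differentiable y t ->
  'D_v (fun t => lightvec c (y t)) t = lightvec 0 ('D_v y t).
Proof.
move=> dy; apply/rowP => j; rewrite -derive_entry; last exact: differentiable_lightvec.
case: (unliftP ord0 j) => [k|] ->.
  by under eq_fun do rewrite lightvecES; rewrite lightvecES derive_entry.
by under eq_fun do rewrite lightvecE0; rewrite lightvecE0 derive_cst.
Qed.

Section DerivedTangency.
Context {V V' : normedModType R} {n : nat}.
Variables (U : set V) (zeta : V -> V') (g : V' -> 'rV[R]_n.+1).
Hypothesis openU : open U.
Hypothesis dzeta : forall t, U t -> differentiable zeta t.
Hypothesis dg : forall t, U t -> differentiable g (zeta t).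

(** A relation between the moving sphere and the point [y t] is differentiated
along the submanifold; applied first to [y = x] and then to its derivatives. *)
Lemma derive_tangency c (y : V -> 'rV[R]_n) t v :
  (forall t, U t -> differentiable y t) ->
  (forall t, U t -> lorentz (g (zeta t)) (lightvec c (y t)) = 0) -> U t ->
  dot (spatial (g (zeta t))) ('D_v y t)
    = - lorentz ('D_('D_v zeta t) g (zeta t)) (lightvec c (y t)).
Proof.
move=> dy gy0 Ut; have dgz : differentiable (g \o zeta) t.
  by apply: differentiable_comp; [exact: dzeta|exact: dg].
have dl : differentiable (fun t => lightvec c (y t)) t.
  exact/differentiable_lightvec/dy.
have : 'D_v (fun t => lorentz ((g \o zeta) t) (lightvec c (y t))) t = 0.
  exact: (derive_locally_constant openU v gy0 Ut).
rewrite derive_lorentz // derive_lightvec; last exact: dy.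
rewrite (derive_comp v (dzeta Ut) (dg Ut)) [X in _ + X]lorentz_lightvec mulr0 subr0.
by move/eqP; rewrite addrC addr_eq0 => /eqP.
Qed.

End DerivedTangency.

Context {m : nat}.
Variables (U : set 'rV[R]_m.+2) (u : 'rV[R]_m.+2).
Variables (x : 'rV[R]_m.+2 -> 'rV[R]_m.+2.+3) (zeta : 'rV[R]_m.+2 -> R * R).
Variables g1 g2 : R * R -> 'rV[R]_m.+2.+4.
Hypothesis openU : open U.
Hypothesis Uu : U u.
Hypothesis sx : smooth U x.
Hypothesis x_sphere : forall t, U t -> dot (x t) (x t) = 1.
Hypothesis x_immersed : forall v, v != 0 -> 'D_v x u != 0.
Hypothesis dzeta : forall t, U t -> differentiable zeta t.
Hypothesis dg1 : forall t, U t -> differentiable g1 (zeta t).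
Hypothesis dg2 : forall t, U t -> differentiable g2 (zeta t).
Hypothesis g1x : forall t, U t -> lorentz (g1 (zeta t)) (lightvec 1 (x t)) = 0.
Hypothesis g2x : forall t, U t -> lorentz (g2 (zeta t)) (lightvec 1 (x t)) = 0.
Hypothesis dg1x : forall t h, U t ->
  lorentz ('D_h g1 (zeta t)) (lightvec 1 (x t)) = 0.
Hypothesis dg2x : forall t h, U t ->
  lorentz ('D_h g2 (zeta t)) (lightvec 1 (x t)) = 0.

Let X1 := g1 (zeta u).
Let X2 := g2 (zeta u).
Variables (a b : 'rV[R]_m.+2.+4) (l1 l2 : R).
Hypothesis Dg1 : 'D_(1, 0) g1 (zeta u) = a.
Hypothesis Dg2 : 'D_(1, 0) g2 (zeta u) = b.
Hypothesis X11 : lorentz X1 X1 = 1.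
Hypothesis X22 : lorentz X2 X2 = 1.
Hypothesis X12 : lorentz X1 X2 = 0.
Hypothesis CR1 : 'D_(0, 1) g1 (zeta u) = b + l2 *: X1 - l1 *: X2.
Hypothesis CR2 : 'D_(0, 1) g2 (zeta u) = - a + l1 *: X1 + l2 *: X2.
Hypothesis aX1 : lorentz a X1 = 0.
Hypothesis bX2 : lorentz b X2 = 0.
Hypothesis bX1 : lorentz b X1 = - lorentz a X2.
Hypothesis ab : lorentz a b = 0.
Hypothesis aabb : lorentz a a = lorentz b b.

Let dx t : U t -> differentiable x t.
Proof. by move=> Ut; exact: smooth_differentiable sx Ut. Qed.

Let x_perp t v : U t -> dot (x t) ('D_v x t) = 0.
Proof.
move=> Ut; have : 'D_v (fun t => dot (x t) (x t)) t = 0.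
  exact: (derive_locally_constant openU v x_sphere Ut).
have dxt := dx Ut.
rewrite derive_dot // [X in X + _]dotC -mulr2n => /eqP.
by rewrite mulrn_eq0 => /eqP.
Qed.

Let spatial_g_tangent (g : R * R -> 'rV[R]_m.+2.+4) t v :
  (forall t, U t -> differentiable g (zeta t)) ->
  (forall t, U t -> lorentz (g (zeta t)) (lightvec 1 (x t)) = 0) ->
  (forall t h, U t -> lorentz ('D_h g (zeta t)) (lightvec 1 (x t)) = 0) ->
  U t -> dot (spatial (g (zeta t))) ('D_v x t) = 0.
Proof.
move=> dg gx dgx Ut; rewrite (derive_tangency openU dzeta dg _ dx gx Ut).
by rewrite dgx // oppr0.
Qed.

Let n1 := spatial X1 - X1 0 0 *: x u.
Let n2 := spatial X2 - X2 0 0 *: x u.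

Let perp_lightvec Z : lorentz Z (lightvec 1 (x u)) = 0 -> dot (spatial Z) (x u) = Z 0 0.
Proof. by rewrite lorentz_lightvec mulr1 => /eqP; rewrite subr_eq0 => /eqP. Qed.

(** Since the moving sphere is tangent to the submanifold, the spatial part of
[g1], [g2] is normal up to a multiple of the position vector, and the Lorentz
product of two vectors orthogonal to [lightvec 1 (x u)] is the Euclidean product
of their normal parts. *)
Lemma tangent_sphere_frame : normal_frame x u n1 n2.
Proof.
have X1x := perp_lightvec (g1x Uu); have X2x := perp_lightvec (g2x Uu).
have xx := x_sphere Uu.
have dotn Z Z' : dot (spatial Z) (x u) = Z 0 0 -> dot (spatial Z') (x u) = Z' 0 0 ->
    dot (spatial Z - Z 0 0 *: x u) (spatial Z' - Z' 0 0 *: x u) = lorentz Z Z'.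
  move=> Zx Zx'; rewrite !dot_bilin Zx (dotC (x u)) Zx' xx lorentz_spatial; ring.
have normal g : (forall v, dot (spatial (g (zeta u))) ('D_v x u) = 0) ->
    dot (spatial (g (zeta u))) (x u) = g (zeta u) 0 0 ->
    normal_vec x u (spatial (g (zeta u)) - g (zeta u) 0 0 *: x u).
  move=> gD gx; split=> [|v]; rewrite !dot_bilin.
    by rewrite gx xx mulr1 subrr.
  by rewrite gD x_perp // mulr0 subr0.
split; rewrite ?dotn //.
  by apply: normal => // v; exact: spatial_g_tangent.
by apply: normal => // v; exact: spatial_g_tangent.
Qed.

Let p : 'cV[R]_m.+2 := \col_i ('D_(delta_mx 0 i) zeta u).1.
Let q : 'cV[R]_m.+2 := \col_i ('D_(delta_mx 0 i) zeta u).2.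
Let A : 'cV[R]_m.+2 := \col_j dot (spatial a) ('D_(delta_mx 0 j) x u).
Let B : 'cV[R]_m.+2 := \col_j dot (spatial b) ('D_(delta_mx 0 j) x u).

(** Differentiating the tangency of [g] to the derivative of [x] moves one
derivative from [x] to [g]; the term with the position vector contributes the
multiple of the metric, since the second derivative of [x] has position component
equal to minus the metric. *)
Let second_form_g (g : R * R -> 'rV[R]_m.+2.+4) i j :
  (forall t, U t -> differentiable g (zeta t)) ->
  (forall t, U t -> lorentz (g (zeta t)) (lightvec 1 (x t)) = 0) ->
  (forall t h, U t -> lorentz ('D_h g (zeta t)) (lightvec 1 (x t)) = 0) ->
  second_form x u (spatial (g (zeta u)) - g (zeta u) 0 0 *: x u) i j
   = g (zeta u) 0 0 * first_form x u i j
     - dot (spatial ('D_('D_(delta_mx 0 i) zeta u) g (zeta u))) ('D_(delta_mx 0 j) x u).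
Proof.
move=> dg gx dgx.
pose y t := 'D_(delta_mx 0 j) x t.
have dy t : U t -> differentiable y t.
  by apply: smooth_differentiable; exact: smooth_derive.
have gy t : U t -> lorentz (g (zeta t)) (lightvec 0 (y t)) = 0.
  by move=> Ut; rewrite lorentz_lightvec mulr0 subr0 spatial_g_tangent.
have xy t : U t -> dot (x t) (y t) = 0 by exact: x_perp.
have := derive_tangency openU dzeta dg (delta_mx 0 i) dy gy Uu.
rewrite lorentz_lightvec mulr0 subr0 => gDy.
have : 'D_(delta_mx 0 i) (fun t => dot (x t) (y t)) u = 0.
  exact: (derive_locally_constant openU _ xy Uu).
have dxu := dx Uu; have dyu := dy u Uu.
rewrite derive_dot // => /eqP; rewrite addrC addr_eq0 => /eqP xDy.
rewrite !mxE !dot_bilin (dotC _ (spatial _)) (dotC _ (x u)).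
rewrite -/y gDy xDy mulrN opprK addrC; congr (_ + _).
Qed.
Let spatial_tangent (g : R * R -> 'rV[R]_m.+2.+4) j : g = g1 \/ g = g2 ->
  dot (spatial (g (zeta u))) ('D_(delta_mx 0 j) x u) = 0.
Proof. by case=> ->; exact: spatial_g_tangent. Qed.

(** By the Cauchy-Riemann relations the derivative of [g1] in direction [(p, q)]
is [p a + q b] up to [g1] and [g2], which are orthogonal to the tangent space;
for [g2] below it is [p b - q a]. *)
Lemma second_form_n1 :
  second_form x u n1 = X1 0 0 *: first_form x u - (p *m A^T + q *m B^T).
Proof.
apply/matrixP => i j; rewrite second_form_g // derive_plane ?Dg1 ?CR1; last exact: dg1.
have t1 := spatial_tangent j (or_introl (erefl g1)).
have t2 := spatial_tangent j (or_intror (erefl g2)).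
rewrite -/X1 in t1; rewrite -/X2 in t2.
rewrite !(spatialD, spatialZ, spatialN) !dot_bilin t1 t2.
by rewrite umbilic_rank2E !mxE !mulr0 addr0 subr0.
Qed.

Lemma second_form_n2 :
  second_form x u n2 = X2 0 0 *: first_form x u - (p *m B^T - q *m A^T).
Proof.
apply/matrixP => i j; rewrite second_form_g // derive_plane ?Dg2 ?CR2; last exact: dg2.
have t1 := spatial_tangent j (or_introl (erefl g1)).
have t2 := spatial_tangent j (or_intror (erefl g2)).
rewrite -/X1 in t1; rewrite -/X2 in t2.
rewrite !(spatialD, spatialZ, spatialN) !dot_bilin t1 t2.
rewrite -[X in _ - (p *m B^T + X)]mulNmx umbilic_rank2E !mxE !mulr0 !addr0 mulrN mulNr.
by [].
Qed.

Lemma second_form_sym n : (second_form x u n)^T = second_form x u n.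
Proof.
apply/matrixP => i j; rewrite [LHS]mxE [LHS]mxE [RHS]mxE.
have sym := derive_sym_mx openU (delta_mx 0 j) (delta_mx 0 i) sx Uu.
exact: (congr1 (fun d => dot d n) sym).
Qed.

(** Modulo the span of [X1] and [X2] the vectors [a] and [b] are orthogonal of the
same length; the quotient of the orthogonal complement of [lightvec 1 (x u)] by
this vector is Euclidean and is the sum of that span and of the tangent space, so
the covectors [A] and [B] inherit both properties. Symmetry of the second forms
then does the rest; being traceless, their nonumbilic parts leave [X1 0 0] and
[X2 0 0] as the mean curvatures of the frame. *)
Theorem wintgen_of_isotropic_congruence :
  wintgen_ideal_at x u /\
  forall n1' n2', normal_frame x u n1' n2' ->
    (mean_xi x u n1' + mean_xi x u n2' == X1 + X2)%MS.
Proof.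
have dxu := dx Uu; have xx := x_sphere Uu.
have xD v : dot (x u) ('D_v x u) = 0 by exact: x_perp.
have frame := tangent_sphere_frame.
have [E0 E0G] := orthonormal_tangent_basis dxu x_immersed.
pose J : 'M[R]_(m.+2, m.+2.+3) := \matrix_(i < m.+2) 'D_(delta_mx 0 i) x u.
have colJ (z : 'rV[R]_m.+2.+3) :
    E0 *m (\col_j dot z ('D_(delta_mx 0 j) x u)) = (z *m (E0 *m J)^T)^T.
  rewrite trmx_mul trmxK -mulmxA; congr (_ *m _); apply/colP => j.
  by rewrite [LHS]mxE dotC dotE [LHS]mxE [RHS]mxE; apply: eq_bigr => l _; rewrite !mxE.
(* Parseval, the components along X1 and X2 being those that are not tangent. *)
have coords Z Z' : lorentz Z (lightvec 1 (x u)) = 0 -> lorentz Z' (lightvec 1 (x u)) = 0 ->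
    dot (spatial Z *m (E0 *m J)^T) (spatial Z' *m (E0 *m J)^T)
    = lorentz Z Z' - lorentz Z X1 * lorentz Z' X1 - lorentz Z X2 * lorentz Z' X2.
  move=> /perp_lightvec Zx /perp_lightvec Zx'.
  have dotn W X : dot (spatial W) (x u) = W 0 0 ->
      dot (spatial W) (spatial X - X 0 0 *: x u) = lorentz W X.
    by move=> Wx; rewrite !dot_bilin Wx lorentz_spatial mulrC.
  have := parseval dxu xx xD frame E0G (spatial Z) (spatial Z').
  rewrite !dotn // Zx Zx' -/J => E1; rewrite (lorentz_spatial Z Z') E1; ring.
have a_x : lorentz a (lightvec 1 (x u)) = 0 by rewrite -Dg1; exact: dg1x.
have b_x : lorentz b (lightvec 1 (x u)) = 0 by rewrite -Dg2; exact: dg2x.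
have [||E [s [EG EA EB]]] := @isotropic_basis R m (first_form x u) E0 A B
    (first_form_sym x u) (first_form_gt0 dxu x_immersed) E0G.
- rewrite !colJ !trmxK (coords a a a_x a_x) (coords b b b_x b_x) aabb aX1 bX1 bX2.
  by rewrite mulrNN !mulr0 !subr0.
- rewrite !colJ !trmxK (coords a b a_x b_x) ab aX1 bX2.
  by rewrite mul0r mulr0 !subr0.
have S1 : second_form x u n1 = X1 0 0 *: first_form x u + - (p *m A^T + q *m B^T).
  exact: second_form_n1.
have S2 : second_form x u n2 = X2 0 0 *: first_form x u + - (p *m B^T - q *m A^T).
  exact: second_form_n2.
have Gs := first_form_sym x u.
have conj_sym n c M : second_form x u n = c *: first_form x u + M ->
    (E *m M *m E^T)^T = E *m M *m E^T.
  move=> SM; have -> : M = second_form x u n - c *: first_form x u.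
    by rewrite SM addrAC subrr add0r.
  rewrite trmx_mul trmx_mul trmxK linearB linearZ /= Gs second_form_sym.
  by rewrite mulmxA.
have conj_outer (v w : 'cV[R]_m.+2) : E *m (v *m w^T) *m E^T = (E *m v) *m (E *m w)^T.
  by rewrite trmx_mul !mulmxA.
have e1 : E *m (- (p *m A^T + q *m B^T)) *m E^T
    = - ((E *m p) *m (s *: delta_mx 0 0)^T + (E *m q) *m (s *: delta_mx (lift 0 0) 0)^T).
  by rewrite -EA -EB mulmxN mulNmx mulmxDr mulmxDl !conj_outer.
have e2 : E *m (- (p *m B^T - q *m A^T)) *m E^T
    = - ((E *m p) *m (s *: delta_mx (lift 0 0) 0)^T - (E *m q) *m (s *: delta_mx 0 0)^T).
  by rewrite -EA -EB mulmxN mulNmx mulmxBr mulmxBl !conj_outer.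
have [c [d [mu [cd F1 F2]]]] :=
  traceless_pair_form e1 e2 (conj_sym _ _ _ S1) (conj_sym _ _ _ S2).
have [wintgen mc1 mc2] := wintgen_of_rotated_forms dxu frame EG S1 S2 cd F1 F2.
split => // n1' n2' frame'.
have xi1E : mean_xi x u n1 = X1.
  by rewrite /mean_xi mc1 subrK -lightvec_spatial.
have xi2E : mean_xi x u n2 = X2.
  by rewrite /mean_xi mc2 subrK -lightvec_spatial.
have sub := mean_sphere_frame_indep dxu xx xD frame EG frame'.
have sup := mean_sphere_frame_indep dxu xx xD frame' EG frame.
by rewrite xi1E xi2E in sub sup; rewrite sub sup.
Qed.
End TangentSphereCongruence.

(** * Lifts of holomorphic isotropic curves *)

Section ComplexRows.
Context {R : realType} {n : nat}.
Implicit Types (P Q : 'rV[R]_n.+1) (f : R * R -> 'rV[R[i]]_n.+1).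

Lemma cplxmxE P Q :
  cplxmx P Q = map_mx (real_complex R) P + 'i%C *: map_mx (real_complex R) Q.
Proof. by apply/rowP => j; rewrite !mxE [LHS]complexE. Qed.

Lemma lorentz_map_real P Q :
  lorentz (map_mx (real_complex R) P) (map_mx (real_complex R) Q)
    = (lorentz P Q)%:C%C.
Proof.
rewrite /lorentz rmorphD rmorphN rmorphM !mxE rmorph_sum; congr (_ + _).
by apply: eq_bigr => i _; rewrite rmorphM !mxE.
Qed.

Lemma lorentz_cplxmx_eq0 P Q : lorentz (cplxmx P Q) (cplxmx P Q) = 0 ->
  lorentz P P = lorentz Q Q /\ lorentz P Q = 0.
Proof.
rewrite cplxmxE !lorentz_bilin !lorentz_map_real (lorentzC Q P).
have -> (x y z : R) : x%:C + 'i%C * y%:C + ('i%C * y%:C + 'i%C * ('i%C * z%:C))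
    = (x - z) +i* (y + y) :> R[i] by simpc.
case=> /eqP; rewrite subr_eq0 => /eqP -> /eqP.
by rewrite -mulr2n mulrn_eq0 /= => /eqP ->.
Qed.

Lemma cplxmx_inj P Q P' Q' : cplxmx P Q = cplxmx P' Q' -> P = P' /\ Q = Q'.
Proof.
move=> /rowP e; split; apply/rowP => j; have := e j; rewrite !mxE; by case.
Qed.

Lemma cplxmx_Re_Im (Z : 'rV[R[i]]_n.+1) : Z = cplxmx (Remx Z) (Immx Z).
Proof. by apply/rowP => j; rewrite !mxE; case: (Z 0 j). Qed.

Lemma scale_cplxmx (l : R[i]) P Q :
  l *: cplxmx P Q = cplxmx (complex.Re l *: P - complex.Im l *: Q)
                           (complex.Re l *: Q + complex.Im l *: P).
Proof. by apply/rowP => j; rewrite !mxE; case: l => l1 l2; simpc. Qed.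

Lemma cplxmxD P Q P' Q' : cplxmx P Q + cplxmx P' Q' = cplxmx (P + P') (Q + Q').
Proof. by apply/rowP => j; rewrite !mxE; simpc. Qed.

Lemma two_wirtzbar f z : 2 *: wirtzbar f z
  = cplxmx ('D_(1, 0) (Remx \o f) z - 'D_(0, 1) (Immx \o f) z)
           ('D_(1, 0) (Immx \o f) z + 'D_(0, 1) (Remx \o f) z).
Proof.
rewrite /wirtzbar scalerA mulfV ?pnatr_eq0 // scale1r.
by rewrite scale_cplxmx /= !scale0r !scale1r cplxmxD sub0r add0r.
Qed.

Lemma two_wirtz f z : 2 *: wirtz f z
  = cplxmx ('D_(1, 0) (Remx \o f) z + 'D_(0, 1) (Immx \o f) z)
           ('D_(1, 0) (Immx \o f) z - 'D_(0, 1) (Remx \o f) z).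
Proof.
rewrite /wirtz scalerA mulfV ?pnatr_eq0 // scale1r -scaleNr.
by rewrite scale_cplxmx /= oppr0 !scale0r !scaleN1r cplxmxD sub0r opprK add0r.
Qed.

End ComplexRows.

(** [P] and [Q] are twice the real and imaginary parts of the complex derivative
of the lift, which differ from [2 a] and [- 2 b] by combinations of [X1] and [X2]. *)
Lemma isotropic_part {R : realType} {n : nat} (a b X1 X2 : 'rV[R]_n.+1) (l1 l2 : R) :
  lorentz X1 X1 = 1 -> lorentz X2 X2 = 1 -> lorentz X1 X2 = 0 ->
  lorentz a X1 = 0 -> lorentz b X2 = 0 -> lorentz b X1 = - lorentz a X2 ->
  let P := a - (- a + l1 *: X1 + l2 *: X2) in
  let Q := - b - (b + l2 *: X1 - l1 *: X2) in
  lorentz P P = lorentz Q Q -> lorentz P Q = 0 ->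
  lorentz a b = 0 /\ lorentz a a = lorentz b b.
Proof.
move=> X11 X22 X12 aX1 bX2 bX1; rewrite /= !lorentz_bilin.
rewrite (lorentzC X1 a) (lorentzC X2 a) (lorentzC X1 b) (lorentzC X2 b).
rewrite (lorentzC X2 X1) aX1 bX2 bX1 X11 X22 X12 => h1 h2.
by split; lra.
Qed.

Section Lifts.
Context {R : realType} {M : riemannSurface R} {n : nat}.
Variable X : M -> 'rV[R[i]]_n.+1.
Hypothesis hX : holomorphic_isotropic_curve X.
Variables (c : chart R M) (W : set (R * R)) (f : R * R -> 'rV[R[i]]_n.+1).
Hypothesis lift : orthonormal_lift X c W f.

Lemma lift_open : open W.
Proof. by case: lift => -[]. Qed.

Lemma smooth_xi1 : smooth W (xi1 f).
Proof. by case: lift => -[]. Qed.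

Lemma smooth_xi2 : smooth W (xi2 f).
Proof.
case: lift => -[oW _ _ sI _] _; apply: smooth_mx => // i j.
apply: (@smooth_ext _ _ _ oW _ (fun z => - (Immx \o f) z i j)).
  by move=> z _; rewrite /xi2 [RHS]mxE.
by apply: smoothN => //; exact: smooth_entry.
Qed.

Lemma derive_Immx z h : W z -> 'D_h (Immx \o f) z = - 'D_h (xi2 f) z.
Proof.
case: lift => -[oW _ _ sI _] _ Wz.
rewrite (_ : xi2 f = - (Immx \o f)) // deriveN ?opprK //.
exact/diff_derivable/(smooth_differentiable sI).
Qed.

Lemma derive_lorentz_cst (g1 g2 : R * R -> 'rV[R]_n.+1) e z h :
  smooth W g1 -> smooth W g2 -> (forall z, W z -> lorentz (g1 z) (g2 z) = e) -> W z ->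
  lorentz ('D_h g1 z) (g2 z) = - lorentz ('D_h g2 z) (g1 z).
Proof.
move=> s1 s2 ge Wz; have := derive_locally_constant lift_open h ge Wz.
have d1 := smooth_differentiable s1 Wz; have d2 := smooth_differentiable s2 Wz.
by rewrite derive_lorentz // [X in _ + X]lorentzC => /eqP; rewrite addr_eq0 => /eqP.
Qed.

(** The first two equations are the Cauchy-Riemann equations for a map that is
holomorphic up to a factor, [l1 + i l2] being twice this factor; the next three
differentiate orthonormality, and the last two express isotropy. *)
Lemma lift_relations z : atlas c -> W z ->
  let a := 'D_(1, 0) (xi1 f) z in let b := 'D_(1, 0) (xi2 f) z in
  let X1 := xi1 f z in let X2 := xi2 f z in
  exists l1 l2 : R,
    [/\ 'D_(0, 1) (xi1 f) z = b + l2 *: X1 - l1 *: X2,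
        'D_(0, 1) (xi2 f) z = - a + l1 *: X1 + l2 *: X2 &
     [/\ lorentz a X1 = 0, lorentz b X2 = 0, lorentz b X1 = - lorentz a X2,
         lorentz a b = 0 & lorentz a a = lorentz b b]].
Proof.
move=> ac Wz a b X1 X2; case: hX => _ _ hol _ iso.
have [llift orth] := lift.
have [l hl] := hol c W f ac llift z Wz.
have lor0 := iso c W f ac llift z Wz.
have half0 (r : R) : r = - r -> r = 0.
  by move=> /eqP; rewrite -addr_eq0 -mulr2n mulrn_eq0 => /eqP.
have o11 w : W w -> lorentz (xi1 f w) (xi1 f w) = 1 by case/orth.
have o22 w : W w -> lorentz (xi2 f w) (xi2 f w) = 1 by case/orth.
have o12 w : W w -> lorentz (xi1 f w) (xi2 f w) = 0 by case/orth.
have o21 w : W w -> lorentz (xi2 f w) (xi1 f w) = 0.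
  by move=> /o12; rewrite lorentzC.
have aX1 : lorentz a X1 = 0.
  by apply: half0; exact: (derive_lorentz_cst _ smooth_xi1 smooth_xi1 o11 Wz).
have bX2 : lorentz b X2 = 0.
  by apply: half0; exact: (derive_lorentz_cst _ smooth_xi2 smooth_xi2 o22 Wz).
have bX1 : lorentz b X1 = - lorentz a X2.
  exact: (derive_lorentz_cst _ smooth_xi2 smooth_xi1 o21 Wz).
have fz : f z = cplxmx X1 (- X2) by rewrite /X1 /X2 opprK; exact: cplxmx_Re_Im.
have : 2 *: wirtzbar f z = (2 * l) *: cplxmx X1 (- X2) by rewrite hl -fz scalerA.
rewrite two_wirtzbar scale_cplxmx !derive_Immx //.
move: (complex.Re _) (complex.Im _) => l1 l2 /cplxmx_inj[e1 e2].
have linE (u v w t : 'rV[R]_n.+1) : - u + v = l1 *: - w + l2 *: t ->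
    v = u + l2 *: t - l1 *: w.
  by move=> e; rewrite -[LHS](addNKr u) e scalerN addrA [RHS]addrAC.
have CR1 : 'D_(0, 1) (xi1 f) z = b + l2 *: X1 - l1 *: X2 by exact: linE e2.
have CR2 : 'D_(0, 1) (xi2 f) z = - a + l1 *: X1 + l2 *: X2.
  by move: e1; rewrite scalerN !opprK -/a => /(congr1 (+%R (- a))); rewrite addKr addrA.
exists l1, l2; split; [exact: CR1|exact: CR2|].
have X11 := o11 z Wz; have X22 := o22 z Wz; have X12 := o12 z Wz.
rewrite -/X1 in X11 X12; rewrite -/X2 in X22 X12.
have lor0' : lorentz (2 *: wirtz f z) (2 *: wirtz f z) = 0.
  by rewrite lorentzZl lorentzZr lor0 !mulr0.
have [h1 h2] : let P := a + - (- a + l1 *: X1 + l2 *: X2) in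
    let Q := - b - (b + l2 *: X1 - l1 *: X2) in
    lorentz P P = lorentz Q Q /\ lorentz P Q = 0.
  rewrite -CR1 -CR2; apply: lorentz_cplxmx_eq0.
  by move: lor0'; rewrite two_wirtz (derive_Immx _ Wz) (derive_Immx _ Wz).
have [ab aabb] := isotropic_part X11 X22 X12 aX1 bX2 bX1 h1 h2.
by split; [exact: aX1|exact: bX2|exact: bX1|exact: ab|exact: aabb].
Qed.

End Lifts.

(** * Points of the envelope *)

Section Envelope.
Context {R : realType} {M : riemannSurface R} {n : nat}.
Variable X : M -> 'rV[R[i]]_n.+1.

Lemma lorentz_comb0 (u v Y : 'rV[R]_n.+1) (a b : R) :
  lorentz u Y = 0 -> lorentz v Y = 0 -> lorentz (a *: u + b *: v) Y = 0.
Proof. by move=> uY vY; rewrite lorentzDl !lorentzZl uY vY !mulr0 addr0. Qed.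

Lemma xi_osc (f : R * R -> 'rV[R[i]]_n.+1) z :
  [/\ (xi1 f z <= osc_span f z)%MS, (xi2 f z <= osc_span f z)%MS,
      ('D_(1, 0) (xi1 f) z <= osc_span f z)%MS,
      ('D_(0, 1) (xi1 f) z <= osc_span f z)%MS &
      ('D_(1, 0) (xi2 f) z <= osc_span f z)%MS /\
      ('D_(0, 1) (xi2 f) z <= osc_span f z)%MS].
Proof.
have := submx_refl (osc_span f z); rewrite {1}/osc_span !addsmx_sub.
move=> /andP[/andP[/andP[/andP[/andP[h1 h2] h3] h4] h5] h6].
by split; [exact: h1|exact: h2|exact: h3|exact: h4|split; [exact: h5|exact: h6]].
Qed.

Lemma osc_perp (f : R * R -> 'rV[R[i]]_n.+1) z (Y : 'rV[R]_n.+1) :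
  differentiable (xi1 f) z -> differentiable (xi2 f) z ->
  (forall w : 'rV[R]_n.+1, (w <= osc_span f z)%MS -> lorentz w Y = 0) ->
  [/\ lorentz (xi1 f z) Y = 0, lorentz (xi2 f z) Y = 0,
      forall h, lorentz ('D_h (xi1 f) z) Y = 0 &
      forall h, lorentz ('D_h (xi2 f) z) Y = 0].
Proof.
move=> d1 d2 perp; have [i1 i2 i3 i4 [i5 i6]] := xi_osc f z.
split; [exact: perp i1|exact: perp i2|move=> h|move=> h].
  by rewrite (derive_plane h d1); exact: lorentz_comb0 (perp _ i3) (perp _ i4).
by rewrite (derive_plane h d2); exact: lorentz_comb0 (perp _ i5) (perp _ i6).
Qed.

(** Two proportional homogeneous coordinates have real and imaginary parts in the
same plane; the components are Lorentz products because the second lift is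
orthonormal. *)
Lemma xi_same_plane (f f' : R * R -> 'rV[R[i]]_n.+1) z w :
  (f z <= f' w)%MS ->
  lorentz (xi1 f' w) (xi1 f' w) = 1 -> lorentz (xi2 f' w) (xi2 f' w) = 1 ->
  lorentz (xi1 f' w) (xi2 f' w) = 0 ->
  forall v, v = xi1 f z \/ v = xi2 f z ->
  v = lorentz v (xi1 f' w) *: xi1 f' w + lorentz v (xi2 f' w) *: xi2 f' w.
Proof.
move=> /sub_rVP[l]; rewrite [f z]cplxmx_Re_Im [f' w]cplxmx_Re_Im scale_cplxmx.
move=> /cplxmx_inj[e1 e2] o11 o22 o12 v.
have {}e1 : xi1 f z = complex.Re l *: xi1 f' w + complex.Im l *: xi2 f' w.
  by rewrite /xi1 e1 /xi2 scalerN.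
have {}e2 : xi2 f z = - complex.Im l *: xi1 f' w + complex.Re l *: xi2 f' w.
  by rewrite {1}/xi2 e2 /xi2 opprD scalerN scaleNr addrC.
have o21 : lorentz (xi2 f' w) (xi1 f' w) = 0 by rewrite lorentzC.
by case=> ->; rewrite ?e1 ?e2 !lorentzDl !lorentzZl o11 o22 o12 o21 !mulr0 !mulr1
  addr0 add0r.
Qed.

Lemma derive_lorentz_cstr (g : R * R -> 'rV[R]_n.+1) (Y : 'rV[R]_n.+1) z h :
  differentiable g z ->
  'D_h (fun z => lorentz (g z) Y) z = lorentz ('D_h g z) Y.
Proof.
move=> dg; rewrite derive_lorentz // derive_cst.
by rewrite [X in _ + X]lorentzC lorentz0l addr0.
Qed.

Lemma derive_mul_vanishing (V : normedModType R) (f g : V -> R) z h :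
  differentiable f z -> differentiable g z -> g z = 0 -> 'D_h g z = 0 ->
  'D_h (fun z => f z * g z) z = 0.
Proof.
move=> df dg g0 Dg0; rewrite deriveM; try exact: diff_derivable.
by rewrite g0 Dg0 scaler0 scale0r addr0.
Qed.

Lemma chart_transition_near (c c' : chart R M) q (A : set (R * R)) :
  cdom c q -> cdom c' q -> open A -> A (cmap c' q) ->
  \forall z \near cmap c q, cdom c' (cinv c z) /\ A (cmap c' (cinv c z)).
Proof.
move=> cq c'q oA Aq; have zq : (cmap c @` cdom c) (cmap c q) by exists q.
have cc : cinv c z @[z --> cmap c q] --> q.
  by rewrite -[X in _ --> X](cmapK cq); exact: cinv_continuous zq.
apply: filterI.
  apply: cc; exact: open_nbhs_nbhs (conj (cdom_open c') c'q).
have := cmap_continuous c'q => cm.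
have cmc : cmap c' (cinv c z) @[z --> cmap c q] --> cmap c' q.
  exact: cvg_comp cc cm.
by apply: cmc; exact: open_nbhs_nbhs.
Qed.

(** Orthogonality to the osculating span does not depend on the lift or the chart.
Near [z] each vector [xi1 f], [xi2 f] is a combination of those of the other lift
[f'], taken at the transition [t]; paired with the fixed vector [Y], every term is
the product of a coefficient with a function that vanishes at [z] together with
its derivative. *)
Lemma envelope_perp (c : chart R M) (W : set (R * R))
    (f : R * R -> 'rV[R[i]]_n.+1) q y :
  atlas c -> orthonormal_lift X c W f -> cdom c q -> W (cmap c q) ->
  envelope X (q, y) ->
  let z := cmap c q in let Y := lightvec 1 y in
  [/\ on_sphere y, lorentz (xi1 f z) Y = 0, lorentz (xi2 f z) Y = 0,
      forall h, lorentz ('D_h (xi1 f) z) Y = 0 &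
      forall h, lorentz ('D_h (xi2 f) z) Y = 0].
Proof.
move=> ac lift cq Wq env z Y.
have [c' [W' [f' [[ac' c'q Wq' lift'] [_ _ sph perp]]]]] := env.
rewrite /= in c'q Wq' sph perp.
have [llift _] := lift; have [oW Wsub _ _ fX] := llift.
have [llift' orth'] := lift'; have [oW' Wsub' _ _ fX'] := llift'.
pose t := cmap c' \o cinv c.
have tz : t z = cmap c' q by rewrite /t /= cmapK.
have [dt _] : holomorphic_at t z by exact: atlas_compat.
have d1 := smooth_differentiable (smooth_xi1 lift) Wq.
have d2 := smooth_differentiable (smooth_xi2 lift) Wq.
have d1' := smooth_differentiable (smooth_xi1 lift') Wq'.
have d2' := smooth_differentiable (smooth_xi2 lift') Wq'.
have [p1 p2 dp1 dp2] := osc_perp d1' d2' perp.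
rewrite -tz in d1' d2' p1 p2 dp1 dp2.
have same : \forall w \near z, forall v, v = xi1 f w \/ v = xi2 f w ->
    v = lorentz v (xi1 f' (t w)) *: xi1 f' (t w)
        + lorentz v (xi2 f' (t w)) *: xi2 f' (t w).
  have nW : \forall w \near z, W w by exact: open_nbhs_nbhs.
  have nT := chart_transition_near cq c'q oW' Wq'.
  apply: filterS2 nW nT => w Ww [c'w W'w].
  have [h11 h22 h12] := orth' _ W'w.
  apply: xi_same_plane h11 h22 h12.
  have /eqmxP e := fX w Ww; have /eqmxP e' := fX' _ W'w.
  by rewrite e e' cmapK.
have main g : differentiable g z ->
    (\forall w \near z, g w = lorentz (g w) (xi1 f' (t w)) *: xi1 f' (t w)
        + lorentz (g w) (xi2 f' (t w)) *: xi2 f' (t w)) ->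
    lorentz (g z) Y = 0 /\ forall h, lorentz ('D_h g z) Y = 0.
  move=> dg gE; split.
    by rewrite (nbhs_singleton gE); exact: lorentz_comb0 p1 p2.
  move=> h; rewrite -derive_lorentz_cstr //.
  have coeff (g' : R * R -> 'rV[R]_n.+1) : differentiable g' (t z) -> lorentz (g' (t z)) Y = 0 ->
      (forall k, lorentz ('D_k g' (t z)) Y = 0) ->
      differentiable (fun w => lorentz (g w) (g' (t w)) * lorentz (g' (t w)) Y) z
      /\ 'D_h (fun w => lorentz (g w) (g' (t w)) * lorentz (g' (t w)) Y) z = 0.
    move=> dg' g'0 Dg'0; have dgt := differentiable_comp dt dg'.
    have da : differentiable (fun w => lorentz (g w) (g' (t w))) z.
      exact: (differentiable_lorentz dg dgt).
    have db : differentiable (fun w => lorentz (g' (t w)) Y) z.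
      by apply: (differentiable_lorentz dgt); exact: differentiable_cst.
    split; first exact: differentiableM.
    apply: derive_mul_vanishing => //.
    apply: etrans (derive_lorentz_cstr Y h dgt) _.
    by rewrite (derive_comp h dt dg'); exact: Dg'0.
  have [da1 Da1] := coeff _ d1' p1 dp1; have [da2 Da2] := coeff _ d2' p2 dp2.
  rewrite -[RHS]addr0 -[X in _ = X + _]Da1 -[X in _ = _ + X]Da2.
  rewrite -deriveD; try exact: diff_derivable.
  apply: near_eq_derive; apply: filterS gE => w gw.
  by rewrite [in LHS]gw lorentzDl !lorentzZl.
have [q1 Dq1] : lorentz (xi1 f z) Y = 0 /\ forall h, lorentz ('D_h (xi1 f) z) Y = 0.
  by apply: main => //; apply: filterS same => w; apply; left.
have [q2 Dq2] : lorentz (xi2 f z) Y = 0 /\ forall h, lorentz ('D_h (xi2 f) z) Y = 0.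
  by apply: main => //; apply: filterS same => w; apply; right.
by split.
Qed.

End Envelope.

(** * Curvature of the envelope *)

Section EnvelopeIsWintgenIdeal.
Context {R : realType}.

(** Multiplication by a complex scalar acts on the real and imaginary parts by a
real matrix. *)
Lemma real_span_of_line n (Z Z' : 'rV[R[i]]_n.+1) : (Z <= Z')%MS ->
  (Remx Z + Immx Z <= Remx Z' + Immx Z')%MS.
Proof.
move=> /sub_rVP[l]; rewrite [Z]cplxmx_Re_Im [Z']cplxmx_Re_Im scale_cplxmx.
move=> /cplxmx_inj[e1 e2].
have ReZ : Remx Z = complex.Re l *: Remx Z' + (- complex.Im l) *: Immx Z'.
  by rewrite e1 scaleNr.
have ImZ : Immx Z = complex.Im l *: Remx Z' + complex.Re l *: Immx Z'.
  by rewrite e2 addrC.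
rewrite -!cplxmx_Re_Im ReZ ImZ addsmx_sub.
by rewrite !addmx_sub_adds // scalemx_sub.
Qed.

Lemma xi_span_line n (f : R * R -> 'rV[R[i]]_n.+1) z (Z : 'rV[R[i]]_n.+1) :
  (f z == Z)%MS -> (xi1 f z + xi2 f z :=: Remx Z + Immx Z)%MS.
Proof.
move=> /andP[fZ Zf]; apply/eqmxP/andP; split.
  apply: submx_trans (real_span_of_line fZ).
  by rewrite addsmx_sub addsmxSl /xi2 -scaleN1r scalemx_sub // addsmxSr.
apply: submx_trans (real_span_of_line Zf) _.
have ImE : Immx (f z) = -1 *: xi2 f z by rewrite scaleN1r /xi2 opprK.
by rewrite addsmx_sub addsmxSl ImE scalemx_sub // addsmxSr.
Qed.

Context {m : nat} {M : riemannSurface R}.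
Variable X : M -> 'rV[R[i]]_(m.+2.+4).
Hypothesis hX : holomorphic_isotropic_curve X.

(** The chart in which the parametrization is smooth need not be the one in which
the lift is given; near [u] the base point read in the latter, [zeta], is still
differentiable, and all points of the envelope are orthogonal to the osculating
span of this single lift. *)
Theorem envelope_wintgen_ideal (U : set 'rV[R]_m.+2)
    (P : 'rV[R]_m.+2 -> M * 'rV[R]_(m.+2.+3)) u :
  local_param (envelope X) U P -> U u ->
  immersed_near (fun u' => (P u').2) u ->
  wintgen_ideal_at (fun u' => (P u').2) u /\
  mean_curvature_sphere_is (fun u' => (P u').2) u (X (P u).1).
Proof.
move=> [oU contP injP openP regP] Uu imm.
have [c [U' [[ac oU' U'u U'U] [cd sz sy _]]]] := regP u Uu.
have envP t : U t -> envelope X ((P t).1, (P t).2).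
  have [N _ PO] := openP U oU (@subset_refl _ U).
  move=> Ut; rewrite -surjective_pairing.
  have : (P @` U) (P t) by exists t.
  by rewrite PO => -[].
have [c0 [W [f [[ac0 c0u Wu lift] _]]]] := envP u Uu.
pose y t := (P t).2; pose zeta t := cmap c0 (P t).1.
have oW := lift_open lift.
have contP1 : (P t).1 @[t --> u] --> (P u).1.
  by apply: cvg_comp; [exact: contP|exact: cvg_fst].
have near_u : \forall t \near u, [/\ U' t, cdom c0 (P t).1 & W (zeta t)].
  have n1 : \forall t \near u, U' t by exact: open_nbhs_nbhs.
  have n2 : \forall t \near u, cdom c0 (P t).1.
    by apply: contP1; exact: open_nbhs_nbhs (conj (cdom_open c0) c0u).
  have n3 : \forall t \near u, W (zeta t).
    have cz : zeta t @[t --> u] --> zeta u.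
      exact: cvg_comp contP1 (cmap_continuous c0u).
    by apply: cz; exact: open_nbhs_nbhs.
  by apply: filterS3 n1 n2 n3.
pose V := interior [set t | [/\ U' t, cdom c0 (P t).1 & W (zeta t)]].
have oV : open V by exact: open_interior.
have Vu : V u by [].
have VE t : V t -> [/\ U' t, cdom c0 (P t).1 & W (zeta t)] by exact: interior_subset.
have VU' : V `<=` U' by move=> t /VE[].
have dzeta t : V t -> differentiable zeta t.
  move=> /VE[U't c0t _].
  have dz := smooth_differentiable sz U't.
  have [dtr _] : holomorphic_at (cmap c0 \o cinv c) (cmap c (P t).1).
    by apply: atlas_compat => //; exact: cd.
  have := differentiable_comp dz dtr; apply: near_eq_differentiable.
  apply: (eq_on_open_near oU' _ U't) => s U's.
  by rewrite /= cmapK //; exact: cd.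
have syV : smooth V y by exact: smooth_sub VU' sy.
have env t (Vt : V t) := let: And3 U't c0t Wt := VE t Vt in
  envelope_perp ac0 lift c0t Wt (envP t (U'U _ U't)).
have x_sph t : V t -> dot (y t) (y t) = 1 by case/env.
have dg1 t : V t -> differentiable (xi1 f) (zeta t).
  by case/VE => _ _; exact: (smooth_differentiable (smooth_xi1 lift)).
have dg2 t : V t -> differentiable (xi2 f) (zeta t).
  by case/VE => _ _; exact: (smooth_differentiable (smooth_xi2 lift)).
have g1x t : V t -> lorentz (xi1 f (zeta t)) (lightvec 1 (y t)) = 0 by case/env.
have g2x t : V t -> lorentz (xi2 f (zeta t)) (lightvec 1 (y t)) = 0 by case/env.
have dg1x t h : V t -> lorentz ('D_h (xi1 f) (zeta t)) (lightvec 1 (y t)) = 0.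
  by case/env => _ _ _ H _; exact: H.
have dg2x t h : V t -> lorentz ('D_h (xi2 f) (zeta t)) (lightvec 1 (y t)) = 0.
  by case/env => _ _ _ _ H; exact: H.
have [_ orth] := lift; have [X11 X22 X12] := orth _ Wu.
have [l1 [l2 [CR1 CR2 [aX1 bX2 bX1 ab aabb]]]] := lift_relations hX lift ac0 Wu.
have y_imm v : v != 0 -> 'D_v y u != 0 by exact: (nbhs_singleton imm).
have [wintgen sphere] := @wintgen_of_isotropic_congruence R m V u y zeta (xi1 f) (xi2 f)
  oV Vu syV x_sph y_imm dzeta dg1 dg2 g1x g2x dg1x dg2x _ _ l1 l2 erefl erefl
  X11 X22 X12 CR1 CR2 aX1 bX2 bX1 ab aabb.
split; first exact: wintgen.
move=> n1 n2 frame; have := sphere n1 n2 frame.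
have [[_ _ _ _ fX] _] := lift; have := fX _ Wu; rewrite cmapK // => /xi_span_line e.
by rewrite !e.
Qed.

End EnvelopeIsWintgenIdeal.

(** * The osculating frame *)

Section OsculatingFrame.
Context {R : realType} {n : nat}.
Implicit Types (f : R * R -> 'rV[R[i]]_n.+1) (z : R * R).

Definition osc_frame f z : 'M[R]_(1 + (1 + (1 + 1)), n.+1) :=
  col_mx (xi1 f z) (col_mx (xi2 f z)
    (col_mx ('D_(1, 0) (xi1 f) z) ('D_(1, 0) (xi2 f) z))).

(** The squared length of the component of [a] (and of [b]) orthogonal to [xi1]
and [xi2]; its positivity is the open condition that makes the osculating span
spacelike of dimension four. *)
Definition osc_gap f z : R :=
  lorentz ('D_(1, 0) (xi1 f) z) ('D_(1, 0) (xi1 f) z)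
  - lorentz ('D_(1, 0) (xi1 f) z) (xi2 f z) ^+ 2.

Lemma lorentz_frame_norm (X1 X2 a b : 'rV[R]_n.+1) (x1 x2 x3 x4 : R) :
  lorentz X1 X1 = 1 -> lorentz X2 X2 = 1 -> lorentz X1 X2 = 0 ->
  lorentz a X1 = 0 -> lorentz b X2 = 0 -> lorentz b X1 = - lorentz a X2 ->
  lorentz a b = 0 -> lorentz a a = lorentz b b ->
  let w := x1 *: X1 + (x2 *: X2 + (x3 *: a + x4 *: b)) in
  lorentz w w = (x1 - lorentz a X2 * x4) ^+ 2 + (x2 + lorentz a X2 * x3) ^+ 2
    + (x3 ^+ 2 + x4 ^+ 2) * (lorentz a a - lorentz a X2 ^+ 2).
Proof.
move=> X11 X22 X12 aX1 bX2 bX1 ab aabb; rewrite /= !lorentz_bilin.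
rewrite (lorentzC X1 a) (lorentzC X2 a) (lorentzC X1 b) (lorentzC X2 b).
rewrite (lorentzC X2 X1) (lorentzC b a) aX1 bX2 bX1 X11 X22 X12 ab -aabb.
ring.
Qed.

Lemma mul_row4 (v : 'rV[R]_(1 + (1 + (1 + 1)))) (X1 X2 a b : 'rV[R]_n.+1) :
  exists x1 x2 x3 x4 : R,
    v = row_mx x1%:M (row_mx x2%:M (row_mx x3%:M x4%:M)) /\
    v *m col_mx X1 (col_mx X2 (col_mx a b))
      = x1 *: X1 + (x2 *: X2 + (x3 *: a + x4 *: b)).
Proof.
exists (lsubmx v 0 0), (lsubmx (rsubmx v) 0 0), (lsubmx (rsubmx (rsubmx v)) 0 0),
  (rsubmx (rsubmx (rsubmx v)) 0 0).
have vE : v = row_mx (lsubmx v 0 0)%:M (row_mx (lsubmx (rsubmx v) 0 0)%:M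
   (row_mx (lsubmx (rsubmx (rsubmx v)) 0 0)%:M (rsubmx (rsubmx (rsubmx v)) 0 0)%:M)).
  by rewrite -!mx11_scalar !hsubmxK.
split; first exact: vE.
by rewrite {1}vE !mul_row_col !mul_scalar_mx.
Qed.

Context {M : riemannSurface R} {X : M -> 'rV[R[i]]_n.+1}.
Hypothesis hX : holomorphic_isotropic_curve X.
Variables (c : chart R M) (W : set (R * R)) (f : R * R -> 'rV[R[i]]_n.+1).
Hypothesis ac : atlas c.
Hypothesis lift : orthonormal_lift X c W f.

(** The Cauchy-Riemann relations express the two derivatives in direction
[(0, 1)] by the four vectors that remain. *)
Lemma osc_frame_span z : W z -> (osc_span f z :=: osc_frame f z)%MS.
Proof.
move=> Wz; have [l1 [l2 [CR1 CR2 _]]] := lift_relations hX lift ac Wz.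
apply/eqmxP/andP; split; last first.
  have [h1 h2 h3 h4 [h5 h6]] := xi_osc f z.
  rewrite /osc_frame !col_mx_sub; apply/and4P.
  by split; [exact: h1|exact: h2|exact: h3|exact: h5].
have := submx_refl (osc_frame f z); rewrite {1}/osc_frame !col_mx_sub.
move=> /and4P[h1 h2 h3 h4]; rewrite /osc_span !addsmx_sub -!andbA.
apply/and5P; split; [exact: h1|exact: h2|exact: h3| |apply/andP; split; [exact: h4|]].
  rewrite CR1 -scaleNr; apply: addmx_sub; last exact: scalemx_sub.
  by apply: addmx_sub; [exact: h4|exact: scalemx_sub].
rewrite CR2 -scaleN1r; apply: addmx_sub; last exact: scalemx_sub.
by apply: addmx_sub; exact: scalemx_sub.
Qed.

Lemma osc_frame_norm z (v : 'rV[R]_(1 + (1 + (1 + 1)))) : W z ->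
  exists x1 x2 x3 x4 k : R, v = row_mx x1%:M (row_mx x2%:M (row_mx x3%:M x4%:M)) /\
  lorentz (v *m osc_frame f z) (v *m osc_frame f z)
   = (x1 - k * x4) ^+ 2 + (x2 + k * x3) ^+ 2 + (x3 ^+ 2 + x4 ^+ 2) * osc_gap f z.
Proof.
move=> Wz; have [l1 [l2 [_ _ [aX1 bX2 bX1 ab aabb]]]] := lift_relations hX lift ac Wz.
have [_ orth] := lift; have [X11 X22 X12] := orth z Wz.
have [x1 [x2 [x3 [x4 [vE vF]]]]] := mul_row4 v (xi1 f z) (xi2 f z)
  ('D_(1, 0) (xi1 f) z) ('D_(1, 0) (xi2 f) z).
exists x1, x2, x3, x4, (lorentz ('D_(1, 0) (xi1 f) z) (xi2 f z)); split; first exact: vE.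
rewrite /osc_frame [v *m _]vF.
exact: (lorentz_frame_norm x1 x2 x3 x4 X11 X22 X12 aX1 bX2 bX1 ab aabb).
Qed.

Lemma osc_frame_pos z (v : 'rV[R]_(1 + (1 + (1 + 1)))) : W z -> 0 < osc_gap f z -> v != 0 ->
  0 < lorentz (v *m osc_frame f z) (v *m osc_frame f z).
Proof.
move=> Wz gap v0; have [x1 [x2 [x3 [x4 [k [vE ->]]]]]] := osc_frame_norm v Wz.
have nn34 : 0 <= x3 ^+ 2 + x4 ^+ 2 by rewrite addr_ge0 ?sqr_ge0.
have nng := mulr_ge0 nn34 (ltW gap).
have nn12 : 0 <= (x1 - k * x4) ^+ 2 + (x2 + k * x3) ^+ 2 by rewrite addr_ge0 ?sqr_ge0.
rewrite lt_neqAle; apply/andP; split; last exact: addr_ge0.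
apply: contraNneq v0 => /esym/eqP.
rewrite paddr_eq0 //.
rewrite mulf_eq0 (gt_eqF gap) orbF !paddr_eq0 ?sqr_ge0 //.
rewrite !sqrf_eq0 => /andP[/andP[e1 e2] /andP[/eqP x30 /eqP x40]].
move: e1 e2; rewrite x30 x40 !mulr0 subr0 addr0 => /eqP x10 /eqP x20.
by rewrite vE x10 x20 x30 x40 !raddf0 !row_mx0.
Qed.

Lemma osc_frame_free z : W z -> 0 < osc_gap f z -> row_free (osc_frame f z).
Proof.
move=> Wz gap; apply: inj_row_free => v vF; apply/eqP/negPn/negP => v0.
by have := osc_frame_pos Wz gap v0; rewrite vF lorentz0l ltxx.
Qed.

(** The vector [a - k xi2], with [k] the product of [a] and [xi2], lies in the span
and has squared length equal to the gap. *)
Lemma osc_gap_gt0 z : W z -> \rank (osc_span f z) = 4%N -> spacelike (osc_span f z) ->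
  0 < osc_gap f z.
Proof.
move=> Wz rk space; have e := osc_frame_span Wz.
have free : row_free (osc_frame f z) by rewrite /row_free -e rk.
have := lift_relations hX lift ac Wz => -[l1 [l2 [_ _ [aX1 bX2 bX1 ab aabb]]]].
have [_ orth] := lift; have [X11 X22 X12] := orth z Wz.
pose k := lorentz ('D_(1, 0) (xi1 f) z) (xi2 f z).
pose v : 'rV[R]_(1 + (1 + (1 + 1))) :=
  row_mx (0 : R)%:M (row_mx (- k)%:M (row_mx (1 : R)%:M (0 : R)%:M)).
have v0 : v != 0.
  apply/eqP => /(congr1 (fun w => (lsubmx (rsubmx (rsubmx w))) 0 0)).
  rewrite /v !row_mxKr row_mxKl !mxE /= => /eqP; by rewrite oner_eq0.
have vF : v *m osc_frame f z != 0.
  by apply: contraNneq v0 => h; apply/eqP; apply: (row_free_inj free); rewrite h mul0mx.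
have := space (v *m osc_frame f z); rewrite e submxMl => /(_ isT vF).
rewrite /osc_frame /v !mul_row_col !mul_scalar_mx.
rewrite (lorentz_frame_norm 0 (- k) 1 0 X11 X22 X12 aX1 bX2 bX1 ab aabb) -/k.
by rewrite mulr0 subr0 mulr1 addNr expr0n expr1n !addr0 add0r mul1r.
Qed.

Lemma osc_frame_perp z (Y : 'rV[R]_n.+1) :
  lorentz (xi1 f z) Y = 0 -> lorentz (xi2 f z) Y = 0 ->
  lorentz ('D_(1, 0) (xi1 f) z) Y = 0 -> lorentz ('D_(1, 0) (xi2 f) z) Y = 0 ->
  forall v : 'rV[R]_(1 + (1 + (1 + 1))), lorentz (v *m osc_frame f z) Y = 0.
Proof.
move=> p1 p2 p3 p4 v.
have [x1 [x2 [x3 [x4 [_ vF]]]]] := mul_row4 v (xi1 f z) (xi2 f z)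
  ('D_(1, 0) (xi1 f) z) ('D_(1, 0) (xi2 f) z).
rewrite /osc_frame [v *m _]vF; move: p1 p2 p3 p4.
move: (xi1 f z) (xi2 f z) ('D_(1, 0) (xi1 f) z) ('D_(1, 0) (xi2 f) z) => X1 X2 a b.
by move=> p1 p2 p3 p4; rewrite !lorentzDl !lorentzZl p1 p2 p3 p4 !mulr0 !addr0.
Qed.

Lemma envelope_intro z y : W z -> 0 < osc_gap f z -> on_sphere y ->
  (forall v : 'rV[R]_(1 + (1 + (1 + 1))), lorentz (v *m osc_frame f z) (lightvec 1 y) = 0) ->
  envelope X (cinv c z, y).
Proof.
move=> Wz gap sph perp; have [[_ Wsub _ _ _] _] := lift.
have [q cq qz] := Wsub z Wz.
have zE : cmap c (cinv c z) = z by rewrite -qz cmapK.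
have cinvq : cdom c (cinv c z) by rewrite -qz cmapK.
have e := osc_frame_span Wz.
exists c, W, f; split; first by split=> //=; rewrite zE.
rewrite /= zE; split=> //.
- rewrite e; exact/eqP/(osc_frame_free Wz gap).
- move=> w; rewrite e => /submxP[v ->] vF0; apply: osc_frame_pos => //.
  by apply: contraNneq vF0 => ->; rewrite mul0mx.
- by move=> w; rewrite e => /submxP[v ->]; exact: perp.
Qed.

End OsculatingFrame.

(** * Transversal lines and the unit sphere *)

Section SphereSlices.
Context {R : realType}.

Lemma basis_of_rank k n r (A : 'M[R]_(k, n)) : \rank A = r ->
  exists B : 'M[R]_(r, n), row_free B /\ (B <= A)%MS.
Proof. by move=> <-; exists (row_base A); rewrite row_base_free eq_row_base. Qed.

(** [nu] is a vector orthogonal to [V] but not to [y], and the rows of [B] complete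
those of [V] to a basis of the hyperplane orthogonal to [nu]. *)
Lemma transversal_frame k j (V : 'M[R]_(k, k + (1 + j))) (y : 'rV[R]_(k + (1 + j))) :
  row_free V -> ~~ (y <= V)%MS ->
  exists (nu : 'rV[R]_(k + (1 + j))) (B : 'M[R]_(j, k + (1 + j))),
    [/\ V *m nu^T = 0, B *m nu^T = 0, 0 < dot y nu &
        col_mx V (col_mx nu B) \in unitmx].
Proof.
move=> Vfree yV.
have [nu Vnu ynu] : exists2 nu : 'rV[R]_(k + (1 + j)), V *m nu^T = 0 & 0 < dot y nu.
  have : y *m cokermx V != 0 by rewrite -submxE.
  move=> /eqP/rowP ne; have [i ynz] : exists i, (y *m cokermx V) 0 i != 0.
    apply/existsP; rewrite -negb_forall; apply/negP => /forallP h; apply: ne => i.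
    by rewrite [RHS]mxE; exact/eqP/h.
  pose w := (col i (cokermx V))^T.
  have Vw : V *m w^T = 0 by rewrite trmxK colE mulmxA mulmx_coker mul0mx.
  have yw : dot y w != 0.
    by rewrite dotE trmxK colE mulmxA -colE mxE.
  have [pos|neg] := ltP 0 (dot y w); first by exists w.
  exists (- w); first by rewrite linearN mulmxN Vw oppr0.
  by rewrite dotNr oppr_gt0 lt_neqAle yw.
have nunz : nu != 0 by apply: contraTneq ynu => ->; rewrite dotC dot0l ltxx.
pose K := kermx nu^T.
have VK : (V <= K)%MS by apply/sub_kermxP.
have rkK : \rank K = (k + j)%N.
  by rewrite mxrank_ker mxrank_tr rank_rV nunz addnCA add1n subn1.
have rkB : \rank (K :\: V)%MS = j.
  have := mxrank_cap_compl K V; rewrite (capmx_idPr VK) rkK (eqP Vfree).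
  by move/addnI.
have [B [Bfree BK]] : exists B : 'M[R]_(j, k + (1 + j)), row_free B /\ (B <= K :\: V)%MS.
  exact: basis_of_rank.
have Bnu : B *m nu^T = 0.
  by apply/sub_kermxP; exact: submx_trans BK (diffmxSl _ _).
exists nu, B; split => //.
rewrite -row_free_unit; apply: inj_row_free => v.
rewrite -[v]hsubmxK -[rsubmx v]hsubmxK !mul_row_col.
move: (lsubmx v) (lsubmx (rsubmx v)) (rsubmx (rsubmx v)) => v1 t v2 e.
have t0 : t = 0.
  have := congr1 (fun w => w *m nu^T) e; rewrite mul0mx !mulmxDl -!mulmxA Vnu Bnu.
  rewrite !mulmx0 add0r addr0 => /(congr1 (fun A : 'M[R]_(1, 1) => A 0 0)).
  rewrite [RHS]mxE mxE big_ord1 -dotE => /eqP; rewrite mulf_eq0 dot_eq0 (negPf nunz) orbF.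
  by move/eqP => t00; apply/matrixP => a b; rewrite !ord1 t00 mxE.
rewrite t0 mul0mx add0r in e.
have v1V : v1 *m V = 0.
  apply/eqP; rewrite -submx0 -(capmx_diff K V) sub_capmx submxMl andbT.
  by move/eqP: e; rewrite addr_eq0 => /eqP ->; rewrite -mulNmx mulmx_sub.
rewrite v1V add0r in e.
have -> : v1 = 0 by apply: (row_free_inj Vfree); rewrite v1V mul0mx.
have -> : v2 = 0 by apply: (row_free_inj Bfree); rewrite e mul0mx.
by rewrite t0 !row_mx0.
Qed.

(** The equation of the unit sphere is quadratic in [t]; its larger root is the
point at which the line leaves the ball. *)
Lemma sphere_meets_line n (r v : 'rV[R]_n) (t : R) : v != 0 ->
  let disc := dot r v ^+ 2 - dot v v * (dot r r - 1) in
  let y := r + t *: v in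
  (dot y y = 1 /\ 0 < dot y v) <->
  (0 < disc /\ t = (Num.sqrt disc - dot r v) / dot v v).
Proof.
move=> v0 disc y; have vv := dot_gt0 v0.
have yvE : dot y v = dot r v + t * dot v v by rewrite /y !dot_bilin.
have yyE : dot y v ^+ 2 - disc = dot v v * (dot y y - 1).
  by rewrite yvE /y /disc !dot_bilin (dotC v r); ring.
split=> [[yy yv]|[d0 tE]].
  have discE : disc = dot y v ^+ 2.
    by apply/eqP; rewrite eq_sym -subr_eq0 yyE yy subrr mulr0.
  split; first by rewrite discE exprn_gt0.
  by rewrite discE sqrtr_sqr gtr0_norm // yvE addrAC subrr add0r mulfK // gt_eqF.
have yv : dot y v = Num.sqrt disc.
  by rewrite yvE tE divfK ?gt_eqF // addrCA subrr addr0.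
split; last by rewrite yv sqrtr_gt0.
apply/eqP; rewrite -subr_eq0; have /eqP := yyE.
rewrite yv sqr_sqrtr ?ltW // subrr eq_sym mulf_eq0 => /orP[/eqP e|//].
by rewrite e ltxx in vv.
Qed.

End SphereSlices.

(** * Smoothly varying affine slices of the sphere *)

Section MovingSlice.
Context {R : realType} {m : nat}.
Local Notation k := (1 + (1 + (1 + 1)))%N.
Variables (F : R * R -> 'M[R]_(k, m.+2.+4)).
Variables (nu0 : 'rV[R]_(k + (1 + m))) (B : 'M[R]_(m, k + (1 + m))).

Definition heads z : 'M[R]_(k, 1) := @lsubmx R k 1 (k + (1 + m)) (F z).
Definition tails z : 'M[R]_(k, k + (1 + m)) := @rsubmx R k 1 (k + (1 + m)) (F z).

(** Orthogonality of a light vector to the rows of [F z] is an inhomogeneous linear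
system for its spatial part. *)
Lemma perp_frame z (y : 'rV[R]_(k + (1 + m))) :
  (forall v : 'rV[R]_k, lorentz (v *m F z) (lightvec 1 (y : 'rV_m.+2.+3)) = 0) <->
  y *m (tails z)^T = (heads z)^T.
Proof.
have E (v : 'rV[R]_k) : lorentz (v *m F z) (lightvec 1 (y : 'rV_m.+2.+3))
    = (v *m (tails z *m y^T - heads z)) 0 0.
  have vF : v *m F z = lightvec ((v *m heads z) 0 0) (v *m tails z : 'rV_m.+2.+3).
    rewrite /lightvec -mx11_scalar; apply: etrans (mul_mx_row v (heads z) (tails z)).
    by rewrite hsubmxK.
  rewrite vF lorentz_lightvec spatial_lightvec lightvecE0 mulr1.
  rewrite mulmxBr mulmxA [RHS]mxE [X in _ = _ + X]mxE.
  by congr (_ - _); exact: dotE.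
split=> [perp|yV v]; last first.
  have h : tails z *m y^T = heads z by rewrite -[LHS]trmxK trmx_mul trmxK yV trmxK.
  by rewrite E h subrr mulmx0 mxE.
have h : tails z *m y^T - heads z = 0.
  apply/colP => i; have := E (delta_mx 0 i); rewrite perp -rowE mxE => <-.
  by rewrite mxE.
move/eqP: h; rewrite subr_eq0 => /eqP h.
by rewrite -h trmx_mul trmxK.
Qed.

(** Besides the equations of the slice at [z], the fixed functionals [nu0] and [B];
their values are coordinates in which the slice is a coordinate subspace. *)
Definition slice_mx z : 'M[R]_(k + (1 + m)) := col_mx (tails z) (col_mx nu0 B).

(** The vector along which only the [nu0]-coordinate varies. *)
Definition slice_dir z : 'rV[R]_(k + (1 + m)) :=
  row_mx (0 : 'rV[R]_k) (row_mx (1%:M : 'M[R]_1) (0 : 'rV[R]_m)) *m (invmx (slice_mx z))^T.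

(** The point of the slice with [B]-coordinates [s] and [nu0]-coordinate [0]. *)
Definition slice_base z (s : 'rV[R]_m) : 'rV[R]_(k + (1 + m)) :=
  row_mx (heads z)^T (row_mx (0 : 'M[R]_1) s) *m (invmx (slice_mx z))^T.

Lemma slice_coords z (y : 'rV[R]_(k + (1 + m))) :
  y *m (slice_mx z)^T
    = row_mx (y *m (tails z)^T) (row_mx (dot y nu0)%:M (y *m B^T)).
Proof. by rewrite /slice_mx !tr_col_mx !mul_mx_row dotE -mx11_scalar. Qed.

Lemma slice_line z s t : slice_base z s + t *: slice_dir z
  = row_mx (heads z)^T (row_mx (t%:M : 'M[R]_1) s) *m (invmx (slice_mx z))^T.
Proof.
rewrite /slice_base /slice_dir scalemxAl -mulmxDl !scale_row_mx !add_row_mx.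
by rewrite scale_scalar_mx mulr1 !scaler0 !addr0 add0r.
Qed.

Lemma invmx_trK z (y : 'rV[R]_(k + (1 + m))) : slice_mx z \in unitmx ->
  y *m (invmx (slice_mx z))^T *m (slice_mx z)^T = y /\
  y *m (slice_mx z)^T *m (invmx (slice_mx z))^T = y.
Proof.
by move=> Au; rewrite -!mulmxA -!trmx_mul mulmxV // mulVmx // trmx1 mulmx1.
Qed.

Lemma on_slice_line z y : slice_mx z \in unitmx -> y *m (tails z)^T = (heads z)^T ->
  y = slice_base z (y *m B^T) + dot y nu0 *: slice_dir z.
Proof.
move=> Au yV; rewrite slice_line -yV -slice_coords.
by have [_ ->] := invmx_trK y Au.
Qed.

Lemma slice_lineP z s t : slice_mx z \in unitmx ->
  let y := slice_base z s + t *: slice_dir z in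
  y *m (tails z)^T = (heads z)^T /\ y *m B^T = s.
Proof.
move=> Au; rewrite /= slice_line.
have [yA _] := invmx_trK (row_mx (heads z)^T (row_mx (t%:M : 'M[R]_1) s)) Au.
move: (_ *m (invmx (slice_mx z))^T) yA => y.
by rewrite slice_coords => /eq_row_mx[-> /eq_row_mx[_ ->]].
Qed.

Lemma slice_dir_neq0 z : slice_mx z \in unitmx -> slice_dir z != 0.
Proof.
move=> Au; apply/eqP => d0.
have [dA _] := invmx_trK (row_mx (0 : 'rV[R]_k) (row_mx (1%:M : 'M[R]_1) (0 : 'rV[R]_m))) Au.
move: dA; rewrite -/(slice_dir z) d0 mul0mx -[0](row_mx0 _ 1 k (1 + m)).
move=> /eq_row_mx[_]; rewrite -(row_mx0 _ 1 1 m) => /eq_row_mx[/matrixP/(_ 0 0)].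
by rewrite !mxE => /eqP; rewrite eq_sym oner_eq0.
Qed.

(** The discriminant of the quadratic equation for the unit vectors on the line
through [slice_base z s] in direction [slice_dir z]. *)
Definition slice_disc z s : R :=
  dot (slice_base z s) (slice_dir z) ^+ 2
  - dot (slice_dir z) (slice_dir z) * (dot (slice_base z s) (slice_base z s) - 1).

Definition slice_point z s : 'rV[R]_(k + (1 + m)) :=
  slice_base z s
  + ((Num.sqrt (slice_disc z s) - dot (slice_base z s) (slice_dir z))
     / dot (slice_dir z) (slice_dir z)) *: slice_dir z.

Lemma slice_pointP z s : slice_mx z \in unitmx -> 0 < slice_disc z s ->
  [/\ dot (slice_point z s) (slice_point z s) = 1,
      0 < dot (slice_point z s) (slice_dir z),
      slice_point z s *m (tails z)^T = (heads z)^T &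
      slice_point z s *m B^T = s].
Proof.
move=> Au d0; have nz := slice_dir_neq0 Au.
have [_ /(_ (conj d0 erefl))[h1 h2]] := sphere_meets_line (slice_base z s)
  ((Num.sqrt (slice_disc z s) - dot (slice_base z s) (slice_dir z))
     / dot (slice_dir z) (slice_dir z)) nz.
have [h3 h4] := slice_lineP s ((Num.sqrt (slice_disc z s)
  - dot (slice_base z s) (slice_dir z)) / dot (slice_dir z) (slice_dir z)) Au.
by split.
Qed.

Lemma slice_point_unique z y : slice_mx z \in unitmx -> dot y y = 1 ->
  y *m (tails z)^T = (heads z)^T -> 0 < dot y (slice_dir z) ->
  0 < slice_disc z (y *m B^T) /\ y = slice_point z (y *m B^T).
Proof.
move=> Au yy yV ynu; have nz := slice_dir_neq0 Au.
have yE := on_slice_line Au yV.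
have [+ _] := sphere_meets_line (slice_base z (y *m B^T)) (dot y nu0) nz.
rewrite /= -yE => /(_ (conj yy ynu))[d0 tE]; split; first exact: d0.
by rewrite [LHS]yE tE.
Qed.

Lemma slice_dirE z : slice_mx z \in unitmx -> tails z *m nu0^T = 0 -> B *m nu0^T = 0 ->
  nu0 != 0 -> slice_dir z = (dot nu0 nu0)^-1 *: nu0.
Proof.
move=> Au Vnu Bnu nz; have [_ <-] := invmx_trK ((dot nu0 nu0)^-1 *: nu0) Au.
congr (_ *m _); rewrite slice_coords -!scalemxAl dotZl mulVf ?gt_eqF ?dot_gt0 //.
have tr0 a (C : 'M[R]_(a, _)) : C *m nu0^T = 0 -> nu0 *m C^T = 0.
  by move=> h; rewrite -[LHS]trmxK trmx_mul trmxK h trmx0.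
by rewrite !tr0 // !scaler0.
Qed.

Section SliceSmoothness.
Variable W : set (R * R).
Hypothesis oW : open W.
Hypothesis sF : smooth W F.

Lemma smooth_heads : smooth W heads.
Proof.
apply: (smooth_mxE oW) => [t i j|]; first by rewrite mxE.
by move=> i j; exact: smooth_entry.
Qed.

Lemma smooth_tails : smooth W tails.
Proof.
apply: (smooth_mxE oW) => [t i j|]; first by rewrite mxE.
by move=> i j; exact: smooth_entry.
Qed.

Lemma smooth_slice_mx : smooth W slice_mx.
Proof.
by apply: smooth_col_mx => //; [exact: smooth_tails|exact: smooth_cst].
Qed.

Hypothesis unitA : forall z, W z -> slice_mx z \in unitmx.

Lemma smooth_slice_inv : smooth W (fun z => (invmx (slice_mx z))^T).
Proof.
by apply: smooth_trmx => //; apply: smooth_invmx => //; exact: smooth_slice_mx.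
Qed.

Lemma smooth_slice_dir : smooth W slice_dir.
Proof.
by apply: smooth_mulmx => //; [exact: smooth_cst|exact: smooth_slice_inv].
Qed.

End SliceSmoothness.

Definition plane_part (u : 'rV[R]_(2 + m)) : R * R :=
  (u 0 (lshift m 0), u 0 (lshift m 1)).

Definition slice_part (u : 'rV[R]_(2 + m)) : 'rV[R]_m := rsubmx u.

Definition join_parts (z : R * R) (s : 'rV[R]_m) : 'rV[R]_(2 + m) :=
  row_mx (\row_(i < 2) if i == 0 then z.1 else z.2) s.

Lemma plane_part_join z s : plane_part (join_parts z s) = z.
Proof. by rewrite /plane_part /join_parts !row_mxEl !mxE /=; case: z. Qed.

Lemma slice_part_join z s : slice_part (join_parts z s) = s.
Proof. exact: row_mxKr. Qed.

Lemma join_partsK u : join_parts (plane_part u) (slice_part u) = u.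
Proof.
rewrite /join_parts -[RHS]hsubmxK; congr row_mx; apply/rowP => i; rewrite !mxE /=.
by case: i => [[|[|//]] hi] /=; congr (u 0 _); exact: val_inj.
Qed.

Lemma differentiable_plane_part u : differentiable plane_part u.
Proof. by apply: differentiable_pair; exact: differentiable_coord. Qed.

Lemma derive_plane_part u h : 'D_h plane_part u = plane_part h.
Proof.
have did : differentiable (@id 'rV[R]_(2 + m)) u by exact: ex_diff.
have coordE l : 'D_h (fun t : 'rV[R]_(2 + m) => t 0 l) u = h 0 l.
  by rewrite (derive_entry h 0 l did) derive_id.
have dcoord l : differentiable (fun t : 'rV[R]_(2 + m) => t 0 l) u.
  exact: differentiable_coord.
rewrite deriveE; last exact: differentiable_plane_part.
rewrite /plane_part diff_pair; [|exact: dcoord|exact: dcoord].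
by rewrite /= -(deriveE h (dcoord _)) -(deriveE h (dcoord _)) !coordE.
Qed.

Section SliceGraph.
Variable W : set (R * R).
Hypothesis oW : open W.
Hypothesis sF : smooth W F.
Hypothesis unitA : forall z, W z -> slice_mx z \in unitmx.

Let U1 := [set u : 'rV[R]_(2 + m) | W (plane_part u)].

Let open_U1 : open U1.
Proof.
apply: open_comp oW => u _; apply: differentiable_continuous.
exact: differentiable_plane_part.
Qed.

Let smooth_pull (Z : normedModType R) (g : R * R -> Z) :
  smooth W g -> smooth U1 (fun u => g (plane_part u)).
Proof.
move=> sg; apply: (smooth_comp_affine (L' := plane_part) open_U1 _ _ _ sg) => //.
- exact: differentiable_plane_part.
- exact: derive_plane_part.
Qed.

Lemma smooth_slice_part : smooth U1 slice_part.
Proof.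
apply: (smooth_mxE open_U1 (g := fun i j u => u i (rshift 2 j))) => [u i j|i j].
  by rewrite mxE.
by apply: (smooth_entry open_U1 (f := id)); exact: smooth_id.
Qed.

Lemma smooth_slice_base : smooth U1 (fun u => slice_base (plane_part u) (slice_part u)).
Proof.
apply: smooth_mulmx => //; last exact: smooth_pull (smooth_slice_inv oW sF unitA).
apply: smooth_row_mx => //.
  exact: (smooth_pull (smooth_trmx oW (smooth_heads oW sF))).
by apply: smooth_row_mx => //; [exact: smooth_cst|exact: smooth_slice_part].
Qed.

Lemma smooth_slice_disc : smooth U1 (fun u => slice_disc (plane_part u) (slice_part u)).
Proof.
have sb := smooth_slice_base.
have sd := smooth_pull (smooth_slice_dir oW sF unitA).
apply: smoothD => //.
  by apply: smoothM => //; exact: smooth_dot.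
apply: smoothN => //; apply: smoothM => //; first exact: smooth_dot.
by apply: smoothD => //; [exact: smooth_dot|exact: smooth_cst].
Qed.

Definition slice_domain := [set u | U1 u /\ 0 < slice_disc (plane_part u) (slice_part u)].

Lemma open_slice_domain : open slice_domain.
Proof.
apply: open_pos_locus => // u Uu; exact: smooth_continuous smooth_slice_disc Uu.
Qed.

Lemma smooth_slice_point :
  smooth slice_domain (fun u => slice_point (plane_part u) (slice_part u)).
Proof.
have sub : slice_domain `<=` U1 by move=> u [].
have oD := open_slice_domain.
have sb := smooth_sub sub smooth_slice_base.
have sd := smooth_sub sub (smooth_pull (smooth_slice_dir oW sF unitA)).
have sD := smooth_sub sub smooth_slice_disc.
apply: smoothD => //; apply: smooth_scalemx => //; apply: smoothM => //.
  apply: smoothD => //; first by apply: smooth_sqrt => // u [].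
  by apply: smoothN => //; exact: smooth_dot.
apply: smoothV => //; last exact: smooth_dot.
by move=> u [/unitA Au _]; rewrite gt_eqF // dot_gt0 // slice_dir_neq0.
Qed.

(** The parameter is recovered from the pair of [z] and the point by the linear
maps [plane_part] and [B], so no direction is lost. *)
Lemma slice_point_immersed u v : slice_domain u -> v != 0 ->
  plane_part v != 0 \/
  'D_v (fun u => slice_point (plane_part u) (slice_part u)) u != 0.
Proof.
move=> Du v0; have [pv0|] := eqVneq (plane_part v) 0; last by left.
right; apply: contraNneq v0 => Dv0.
have dsp := smooth_differentiable smooth_slice_point Du.
suff sv0 : slice_part v = 0.
  rewrite -[v]join_partsK pv0 sv0 /join_parts; apply/eqP/rowP => i; rewrite !mxE.
  by case: splitP => j _; rewrite !mxE //; case: ifP.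
apply/rowP => j; rewrite [RHS]mxE [LHS]mxE.
have did : differentiable (@id 'rV[R]_(2 + m)) u by exact: ex_diff.
have <- : 'D_v (fun t : 'rV[R]_(2 + m) => t 0 (rshift 2 j)) u = v 0 (rshift 2 j).
  by rewrite (derive_entry v 0 (rshift 2 j) did) derive_id.
have <- : 'D_v (fun t => dot (slice_point (plane_part t) (slice_part t)) (row j B)) u = 0.
  rewrite derive_dot; [|exact: dsp|exact: differentiable_cst].
  by rewrite Dv0 derive_cst dot0l dotC dot0l addr0.
apply: near_eq_derive; apply: (eq_on_open_near open_slice_domain _ Du) => t [/unitA Au d0].
have [_ _ _ spB] := slice_pointP Au d0.
have : slice_part t 0 j = t 0 (rshift 2 j) by rewrite mxE.
by rewrite -{1}spB => <-; rewrite dotE !mxE; apply: eq_bigr => l _; rewrite !mxE.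
Qed.

End SliceGraph.

End MovingSlice.

(** * The envelope is a submanifold *)

Lemma near_preimage {T T' : topologicalType} (h : T -> T') x (A : set T') :
  {for x, continuous h} -> open A -> A (h x) -> \forall t \near x, A (h t).
Proof. by move=> ch oA Ax; exact: ch _ (open_nbhs_nbhs (conj oA Ax)). Qed.

Lemma near_fst {T T' : topologicalType} x (y : T') (A : set T) :
  open A -> A x -> \forall t \near (x, y), A t.1.
Proof. by move=> oA Ax; apply: cvg_fst; exact: open_nbhs_nbhs. Qed.

Section EnvelopeSubmanifold.
Context {R : realType} {m : nat} {M : riemannSurface R}.
Variable X : M -> 'rV[R[i]]_(m.+2.+4).
Hypothesis hX : holomorphic_isotropic_curve X.
Local Notation k := (1 + (1 + (1 + 1)))%N.

Lemma smooth_osc_frame (W : set (R * R)) (f : R * R -> 'rV[R[i]]_(m.+2.+4)) :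
  open W -> smooth W (xi1 f) -> smooth W (xi2 f) -> smooth W (osc_frame f).
Proof.
move=> oW s1 s2; apply: smooth_col_mx => //; apply: smooth_col_mx => //.
by apply: smooth_col_mx => //; exact: smooth_derive.
Qed.

Lemma smooth_osc_gap (W : set (R * R)) (f : R * R -> 'rV[R[i]]_(m.+2.+4)) :
  open W -> smooth W (xi1 f) -> smooth W (xi2 f) -> smooth W (osc_gap f).
Proof.
move=> oW s1 s2; have sD : smooth W (fun z => 'D_(1, 0) (xi1 f) z) := smooth_derive _ s1.
apply: smoothD => //; first exact: smooth_lorentz.
apply: smoothN => //; under eq_fun do rewrite expr2.
by apply: smoothM => //; exact: smooth_lorentz.
Qed.

(** A combination of the frame with zero spatial part would be timelike or zero,
and one whose spatial part is [y] would be the light vector of [y] itself. *)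
Lemma spacelike_tails (F : R * R -> 'M[R]_(k, m.+2.+4)) z (y : 'rV[R]_(k + (1 + m))) :
  (forall v : 'rV[R]_k, v != 0 -> 0 < lorentz (v *m F z) (v *m F z)) ->
  dot y y = 1 -> y *m (tails F z)^T = (heads F z)^T ->
  row_free (tails F z) /\ ~~ (y <= tails F z)%MS.
Proof.
move=> pos yy yV; have perp := (perp_frame F z y).2 yV.
have vF (v : 'rV[R]_k) : v *m F z
    = lightvec ((v *m heads F z) 0 0) (v *m tails F z : 'rV[R]_m.+2.+3).
  rewrite /lightvec -mx11_scalar; apply: etrans (mul_mx_row v (heads F z) (tails F z)).
  by rewrite hsubmxK.
split.
  apply: inj_row_free => v v0; apply/eqP/negPn/negP => /pos.
  rewrite vF v0 lorentz_lightvec spatial_lightvec lightvecE0 dot0l sub0r -expr2.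
  by rewrite oppr_gt0 ltNge sqr_ge0.
apply/negP => /submxP[v yE].
have v0 : v != 0.
  by apply: contraTneq (oner_neq0 R) => v0; rewrite -yy yE v0 mul0mx dot0l eqxx.
have := perp v; rewrite vF -yE lorentz_lightvec spatial_lightvec lightvecE0 mulr1.
move=> /eqP; rewrite [X in X - _]yy subr_eq0 => /eqP h1.
have := pos v v0; rewrite vF -yE -h1 lorentz_lightvec spatial_lightvec lightvecE0.
by rewrite [X in X - _]yy mulr1 subrr ltxx.
Qed.

Lemma continuous_pair_dot n (g : R * R -> 'rV[R]_n) z y : {for z, continuous g} ->
  {for (z, y), continuous (fun zy : (R * R) * 'rV[R]_n => dot zy.2 (g zy.1))}.
Proof.
move=> cg.
have cg1 : g w.1 @[w --> (z, y)] --> g z.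
  apply: (@cvg_comp _ _ _ fst g _ (nbhs z)); [exact: cvg_fst|exact: cg].
have entry (h : (R * R) * 'rV[R]_n -> 'rV[R]_n) l :
    h w @[w --> (z, y)] --> h (z, y) -> h w 0 l @[w --> (z, y)] --> h (z, y) 0 l.
  move=> ch; apply: (@cvg_comp _ _ _ h (fun v : 'rV[R]_n => v 0 l) _ (nbhs (h (z, y)))).
    exact: ch.
  exact: coord_continuous.
suff sums (r : seq 'I_n) :
    (fun w : (R * R) * 'rV[R]_n => \sum_(l <- r) w.2 0 l * g w.1 0 l) @ (z, y) -->
    \sum_(l <- r) y 0 l * g z 0 l by exact: sums.
elim: r => [|l r IH].
  by under eq_fun do rewrite big_nil; rewrite big_nil; exact: cvg_cst.
under eq_fun do rewrite big_cons.
rewrite big_cons; apply: cvgD IH; apply: cvgM.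
  by apply: (entry snd); exact: cvg_snd.
exact: (entry (fun w => g w.1)).
Qed.

Lemma continuous_join_parts (B : 'M[R]_(m, k + (1 + m))) :
  continuous (fun zy : (R * R) * 'rV[R]_(k + (1 + m)) => join_parts zy.1 (zy.2 *m B^T)).
Proof.
pose e0 := join_parts (1 : R, 0 : R) (0 : 'rV[R]_m).
pose e1 := join_parts (0 : R, 1 : R) (0 : 'rV[R]_m).
pose N : 'M[R]_(k + (1 + m), 2 + m) := row_mx 0 B^T.
have E : (fun zy : (R * R) * 'rV[R]_(k + (1 + m)) => join_parts zy.1 (zy.2 *m B^T))
    = (fun zy => zy.1.1 *: e0 + zy.1.2 *: e1 + zy.2 *m N).
  apply/funext => -[[z1 z2] y] /=; rewrite /N mul_mx_row mulmx0 /e0 /e1 /join_parts.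
  rewrite !scale_row_mx !add_row_mx !scaler0 !add0r addr0; congr row_mx.
  apply/rowP => i; rewrite !mxE /=.
  by case: ifP => _; rewrite ?mulr1 ?mulr0 ?addr0 ?add0r.
have cN : continuous (fun y : 'rV[R]_(k + (1 + m)) => y *m N).
  move=> y; apply: differentiable_continuous; apply: differentiable_mx => i j.
  have -> : (fun t : 'rV[R]_(k + (1 + m)) => (t *m N) i j)
      = (fun t => dot t (col j N)^T).
    by apply/funext => t; rewrite mxE ord1; apply: eq_bigr => l _; rewrite !mxE.
  by apply: differentiable_dot; [exact: ex_diff|exact: differentiable_cst].
rewrite E => -[[z1 z2] y]; apply: cvgD; first apply: cvgD.
- apply: cvgZr_tmp; apply: (@cvg_comp _ _ _ (fun zy => zy.1) fst _ (nbhs (z1, z2))).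
    exact: cvg_fst.
  exact: cvg_fst.
- apply: cvgZr_tmp; apply: (@cvg_comp _ _ _ (fun zy => zy.1) snd _ (nbhs (z1, z2))).
    exact: cvg_fst.
  exact: cvg_snd.
- apply: (@cvg_comp _ _ _ snd (fun y => y *m N) _ (nbhs y)); [exact: cvg_snd|exact: cN].
Qed.

(** Over a point [z] near the base point of [p] the envelope consists of the unit
vectors in an affine subspace that varies smoothly with [z]. The coordinates are
[z] and the values of the fixed functionals [B]; they leave a line, which meets
the sphere transversally at [p], and hence nearby in one point close to [p].
The condition [0 < dot y (slice_dir F nu B z)] selects this point. *)
Theorem envelope_local_param p : envelope X p ->
  exists (U : set 'rV[R]_m.+2) (P : 'rV[R]_m.+2 -> M * 'rV[R]_(m.+2.+3)) u,
    [/\ local_param (envelope X) U P, U u & P u = p].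
Proof.
case: p => q0 y0 env; have [c [W [f [[ac cq0 Wq0 lift] [rk space sph perp]]]]] := env.
rewrite /= in cq0 Wq0 rk space sph perp.
have oW := lift_open lift; have s1 := smooth_xi1 lift; have s2 := smooth_xi2 lift.
have [[_ Wsub _ _ _] _] := lift.
pose z0 := cmap c q0; pose F := osc_frame f.
have gap0 : 0 < osc_gap f z0 := osc_gap_gt0 hX ac lift Wq0 rk space.
have envF q y : cdom c q -> W (cmap c q) -> envelope X (q, y) ->
    on_sphere y /\ (y : 'rV[R]_(k + (1 + m))) *m (tails F (cmap c q))^T = (heads F (cmap c q))^T.
  move=> cq Wq /(envelope_perp ac lift cq Wq)[sy p1 p2 dp1 dp2]; split; first exact: sy.
  apply/perp_frame; exact: osc_frame_perp p1 p2 (dp1 _) (dp2 _).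
have [_ yV0] := envF q0 y0 cq0 Wq0 env.
have pos0 (v : 'rV[R]_k) : v != 0 -> 0 < lorentz (v *m F z0) (v *m F z0).
  exact: (osc_frame_pos hX ac lift Wq0 gap0).
have [Vfree yV] := spacelike_tails pos0 sph yV0.
have [nu [B [Vnu Bnu ynu Aunit0]]] := transversal_frame Vfree yV.
have nu_neq0 : nu != 0 by apply: contraTneq ynu => ->; rewrite dotC dot0l ltxx.
pose W1 := [set z | W z /\ 0 < osc_gap f z].
have oW1 : open W1.
  apply: open_pos_locus => // z Wz.
  exact: smooth_continuous (smooth_osc_gap oW s1 s2) Wz.
have sF1 : smooth W1 F.
  by apply: smooth_sub (smooth_osc_frame oW s1 s2) => z [].
pose A := slice_mx F nu B.
(* Invertibility of A z as a positivity condition, which is visibly open. *)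
pose W2 := [set z | W1 z /\ 0 < \det (A z) * \det (A z)].
have oW2 : open W2.
  apply: open_pos_locus => // z Wz.
  have sdet : smooth W1 (fun z => \det (A z)).
    by apply: smooth_det => //; exact: smooth_slice_mx.
  by apply: smooth_continuous Wz; exact: smoothM.
have sF : smooth W2 F by apply: smooth_sub sF1 => z [].
have unitA z : W2 z -> A z \in unitmx.
  move=> [_ dd]; rewrite unitmxE unitfE; apply: contraTneq dd => ->.
  by rewrite mul0r ltxx.
have W2z0 : W2 z0.
  split; first by split.
  by rewrite -expr2 exprn_even_gt0 //= -unitfE -unitmxE.
pose U := slice_domain F nu B W2.
have oU : open U := open_slice_domain oW2 sF unitA.
pose y u := slice_point F nu B (plane_part u) (slice_part u).
pose P (u : 'rV[R]_m.+2) : M * 'rV[R]_(m.+2.+3) := (cinv c (plane_part u), y u).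
have cmapP u : U u -> cmap c (cinv c (plane_part u)) = plane_part u
    /\ cdom c (cinv c (plane_part u)).
  move=> [[[/Wsub[q cq qE] _] _] _]; rewrite -qE.
  by rewrite cmapK.
(* The coordinates of an arbitrary point: a continuous left inverse of P. *)
pose back (zy : (R * R) * 'rV[R]_(m.+2.+3)) : 'rV[R]_m.+2 :=
  join_parts zy.1 ((zy.2 : 'rV[R]_(k + (1 + m))) *m B^T).
have backP u : U u -> back (cmap c (P u).1, (P u).2) = u.
  move=> Uu; have [zE _] := cmapP u Uu; rewrite /back /= zE.
  have [/unitA Au d0] := Uu; have [_ _ _ ->] := slice_pointP Au d0.
  exact: join_partsK.
have Pback q y' : cdom c q -> U (back (cmap c q, y')) -> envelope X (q, y') ->
    0 < dot y' (slice_dir F nu B (cmap c q)) -> P (back (cmap c q, y')) = (q, y').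
  move=> cq [W2z d0] eqy ypos; rewrite /back /= in W2z d0.
  rewrite plane_part_join in W2z.
  have [sy yV'] := envF q y' cq (proj1 (proj1 W2z)) eqy.
  have [_ yE] := slice_point_unique (unitA _ W2z) sy yV' ypos.
  by rewrite /P /y /back /= plane_part_join slice_part_join -yE cmapK.
have dir0 : 0 < dot y0 (slice_dir F nu B z0).
  by rewrite slice_dirE // dotZr mulr_gt0 // invr_gt0 dot_gt0.
have U0 : U (back (z0, y0)).
  rewrite /U /slice_domain /= /back /=.
  have [d0 _] := slice_point_unique Aunit0 sph yV0 dir0.
  by split; rewrite /= plane_part_join ?slice_part_join.
exists U, P, (back (z0, y0)); split; [split|exact: U0|exact: Pback].
- exact: oU.
- move=> u Uu; have [[[/Wsub zc _] _] _] := Uu.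
  have c1 : (fun t => cinv c (plane_part t)) @ u --> cinv c (plane_part u).
    apply: (@cvg_comp _ _ _ (@plane_part R m) (cinv c) _ (nbhs (plane_part u))).
      exact: differentiable_continuous (differentiable_plane_part u).
    exact: cinv_continuous zc.
  have c2 : y @ u --> y u.
    exact: smooth_continuous (smooth_slice_point oW2 sF unitA) Uu.
  exact: (cvg_pair c1 c2).
- move=> u v /set_mem Uu /set_mem Uv /(congr1 (fun p => back (cmap c p.1, p.2))) Puv.
  exact: etrans (esym (backP u Uu)) (etrans Puv (backP v Uv)).
- move=> U' oU' U'U.
  pose G := [set zy : (R * R) * 'rV[R]_(m.+2.+3) |
    [/\ W2 zy.1, U' (back zy) & 0 < dot zy.2 (slice_dir F nu B zy.1)]].
  have oG : open G.
    rewrite openE => -[z y'] [W2z U'b ypos].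
    have n1 : \forall w \near (z, y'), W2 w.1.
      exact: near_fst oW2 W2z.
    have n2 : \forall w \near (z, y'), U' (back w).
      exact: near_preimage (@continuous_join_parts B (z, y')) oU' U'b.
    have n3 : \forall w \near (z, y'), 0 < dot w.2 (slice_dir F nu B w.1).
      have cd : {for z, continuous (slice_dir F nu B)}.
        exact: smooth_continuous (smooth_slice_dir oW2 sF unitA) W2z.
      exact: cvgr_gt (continuous_pair_dot (y := y') cd) _ ypos.
    by apply: filterS3 n1 n2 n3; split.
  exists [set qy : M * 'rV[R]_(m.+2.+3) | cdom c qy.1 /\ G (cmap c qy.1, qy.2)].
    rewrite openE => -[q y'] [cq Gqy].
    have n1 : \forall w \near (q, y'), cdom c w.1.
      exact: near_fst (cdom_open c) cq.
    have c1 : (fun w : M * 'rV[R]_(m.+2.+3) => cmap c w.1) @ (q, y') --> cmap c q.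
      apply: (@cvg_comp _ _ _ fst (cmap c) _ (nbhs q)); first exact: cvg_fst.
      exact: cmap_continuous cq.
    have c2 : (fun w : M * 'rV[R]_(m.+2.+3) => w.2) @ (q, y') --> y' by exact: cvg_snd.
    have cm : {for (q, y'), continuous
        (fun w : M * 'rV[R]_(m.+2.+3) => (cmap c w.1, w.2))}.
      exact: (cvg_pair c1 c2).
    have n2 : \forall w \near (q, y'), G (cmap c w.1, w.2).
      exact: near_preimage cm oG Gqy.
    exact: filterI n1 n2.
  apply/seteqP; split=> [_ [u U'u <-]|[q y'] [eqy [cq [W2z U'b ypos]]]].
    have Uu := U'U _ U'u; have [W2u d0] := Uu; have [zE cu] := cmapP u Uu.
    have [sy spos syV _] := slice_pointP (unitA _ W2u) d0.
    split; last first.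
      split; first exact: cu.
      have bu := backP u Uu.
      by split; [rewrite /= zE|rewrite bu|rewrite /= zE; exact: spos].
    apply: (envelope_intro hX ac lift); [exact: (proj1 (proj1 W2u))|
      exact: (proj2 (proj1 W2u))|exact: sy|exact/perp_frame].
  exists (back (cmap c q, y')); first exact: U'b.
  exact: Pback cq (U'U _ U'b) eqy ypos.
- move=> u Uu; exists c, U; split; first by split.
  have zE v : U v -> plane_part v = cmap c (P v).1 by move=> /cmapP[].
  split.
  + by move=> v /cmapP[].
  + apply: (smooth_ext oU zE).
    apply: (smooth_comp_affine (L := plane_part) (L' := plane_part) (U := setT)
      (f := id) oU) => //; [exact: differentiable_plane_part|exact: derive_plane_part|].
    exact: smooth_id.
  + exact: smooth_slice_point.
  + move=> v /(slice_point_immersed oW2 sF unitA Uu)[pv|Dv]; [left|right; exact: Dv].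
    have <- : 'D_v plane_part u = 'D_v (fun u' => cmap c (P u').1) u.
      by apply: near_eq_derive; exact: (eq_on_open_near oU zE Uu).
    by rewrite derive_plane_part.
Qed.

End EnvelopeSubmanifold.

Theorem theorem5p2 (R : realType) (m : nat) (hm : (2 <= m)%N)
    (M : riemannSurface R) (X : M -> 'rV[R[i]]_(m.+4))
    (hX : holomorphic_isotropic_curve X) :
  (forall p, envelope X p ->
     exists (U : set 'rV[R]_m) (P : 'rV[R]_m -> M * 'rV[R]_(m.+3)) u,
       [/\ local_param (envelope X) U P, U u & P u = p]) /\
  (forall (U : set 'rV[R]_m) (P : 'rV[R]_m -> M * 'rV[R]_(m.+3)) u,
     local_param (envelope X) U P -> U u ->
     immersed_near (fun u' => (P u').2) u ->
     wintgen_ideal_at (fun u' => (P u').2) u /\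
     mean_curvature_sphere_is (fun u' => (P u').2) u (X (P u).1)).
Proof.
case: m hm X hX => [|[|m]] // _ X hX; split.
  exact: envelope_local_param.
exact: envelope_wintgen_ideal.
Qed.
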